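(* Let $n\geq 1$ be an integer. Suppose that $\mathfrak{d}=\aleph_n$, that there exists an $\omega_n$-chain $C$ which is unbounded in $({}^\omega\omega,\leq^* )$, that $w\Diamond(S^k_{k+1})$ holds for all $k<n$, and that $2^{\aleph_0}<2^{\aleph_1}$. Then for every nontrivial abelian group $G$ there exists an $n$-coherent family $\bar{x}$ for $G$ on ${}^\omega\omega$ such that the restriction of $\bar{x}$ to $C$ is nontrivial. In particular, $\lim^n \mathbf{A}_G\neq 0$.
   Context: For $f,g\in{}^\omega\omega$: $f\leq g$ means $f(i)\leq g(i)$ for all $i$; $f\leq^* g$ means $f(i)\leq g(i)$ for all but finitely many $i$. $\mathfrak{d}$ is the least size of a cofinal subset of $({}^\omega\omega,\leq^* )$. A $\kappa$-chain in a quasi-order $(P,\leq)$ is a subset $C\subseteq P$ with a bijection $\sigma:\kappa\to C$ such that $\alpha\leq\beta$ implies $\sigma(\alpha)\leq\sigma(\beta)$; it is unbounded in $P$ if no single element of $P$ is above all elements of $C$. Chains in ${}^\omega\omega$ are with respect to $\leq^*$. $S^k_{k+1}=\{\alpha<\omega_{k+1}\mid \mathrm{cof}(\alpha)=\omega_k\}$. For a stationary $S\subseteq\kappa$ ($\kappa$ regular uncountable), the weak diamond $w\Diamond(S)$ says: for every $F:2^{<\kappa}\to 2$ there is $g:\kappa\to 2$ such that for every $b:\kappa\to 2$ the set $\{\lambda\in S\mid g(\lambda)=F(b\restriction\lambda)\}$ is stationary in $\kappa$. $\mathbf{A}_G$ is the inverse system indexed by $({}^\omega\omega,\leq)$ with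 groups $\bigoplus_{i\in\omega}G^{f(i)}$ and bonding maps the coordinate projections; $\lim^n$ is the $n$-th right derived functor of the inverse limit. Families. Let $I_f=\{(i,j)\in\omega\times\omega\mid j<f(i)\}$, and identify $\prod_{i}G^{f(i)}$ with the functions $I_f\to G$. Let $=^*$ denote equality at all but finitely many points. Let $Q_f=\prod_{i\in\omega}G^{f(i)}/\bigoplus_{i\in\omega}G^{f(i)}$, with the natural projections $p^{g}_f:Q_g\to Q_f$ for $f\leq^* g$. For a $\leq^*$-directed $P\subseteq{}^\omega\omega$ and $m\geq 0$ let $K^m(P)=\prod Q_{f_0}$, the product over all tuples $f_0\leq^*\dots\leq^* f_m$ in $P$, and for $m\geq 1$ let $\delta^m:K^{m-1}(P)\to K^m(P)$ be $\delta^m(x)_{f_0\dots f_m}=p^{f_1}_{f_0}(x_{f_1\dots f_m})+\sum_{i=1}^m(-1)^i x_{f_0\dots\widehat{f_i}\dots f_m}$. For $n=1$: a $1$-coherent family for $G$ on $P$ is a family $\langle\phi_f:I_f\to G\mid f\in P\rangle$ with $\phi_f\restriction(I_f\cap I_g)=^*\phi_g\restriction(I_f\cap I_g)$ for all $f,g\in P$; its restriction to $C\subseteq P$ is nontrivial if there is no $\psi:\omega\times\omega\to G$ with $\psi\restriction I_f=^*\phi_f$ for all $f\in C$. For $n\geq 2$: an $n$-coherent family for $G$ on $P$ is $\bar{x}\in K^{n-1}(P)$ with $\delta^n(\bar{x})=0$; its restriction to a chain $C\subseteq P$ is nontrivial if there is no $\bar{y}\in K^{n-2}(C)$ such that $\delta^{n-1}(\bar{y})$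 equals the restriction of $\bar{x}$ to the $\leq^*$-increasing $n$-tuples of $C$. *)

(* Defs.v *)
From HB Require Import structures.
From mathcomp Require Import all_boot all_order all_algebra.
From mathcomp Require Import ring_quotient generic_quotient.
From mathcomp Require Import all_classical wochoice.

Set Implicit Arguments.
Unset Strict Implicit.
Unset Printing Implicit Defensive.

Import Order.TTheory GRing.Theory.

Local Open Scope classical_set_scope.
Local Open Scope card_scope.

(** * Ordinals and cardinals *)

(* An ordinal is represented by a well-ordered type; its elements are the
   smaller ordinals, an element x standing for the order type of [wseg x]. *)
Record woset := Woset {
  wo_sort :> Type;
  wle : rel wo_sort;
  wleP : well_order wle
}.
Arguments wle {w}.

Definition wlt (W : woset) (x y : W) : bool := wle x y && ~~ wle y x.

Definition wseg (W : woset) (x : W) : set W := [set y | wlt y x].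

Definition card_lt T U (A : set T) (B : set U) : bool :=
  (A #<= B) && ~~ (B #<= A).

Lemma leq_well_order : well_order leq.
Proof.
apply: antisymmetric_well_order; first exact: anti_leq.
move=> A [x Ax]; have exA : exists y, y \in A by exists x.
by exists (ex_minn exA); case: ex_minnP => m Am mP; split=> // y /mP.
Qed.

Definition omega0 : woset := Woset leq_well_order.

Section Successor.
Variable W : woset.

(* Some well-order of the power set of W. *)
Definition powW : woset :=
  Woset (proj2_sig (well_ordering_principle (set W))).

Definition succ_sort : Type := {X : powW | wseg X #<= [set: W]}.

Lemma sval_inj : injective (sval : succ_sort -> powW).
Proof. exact: val_inj. Qed.

Definition succ_le : rel succ_sort := fun X Y => wle (sval X) (sval Y).

Lemma succ_le_well_order : well_order succ_le.
Proof.
move=> A [X AX].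
pose B : {pred powW} := fun Y => `[< exists2 Z, Z \in A & sval Z = Y >].
have [|Y [[/asboolP[Z AZ ZY] Ymin] Yuniq]] := @wleP powW B.
  by exists (sval X); apply/asboolP; exists X.
exists Z; split=> [|Z' [AZ' Z'min]].
  split=> // U AU; rewrite /succ_le ZY; apply: Ymin.
  by apply/asboolP; exists U.
apply: sval_inj; rewrite ZY; apply: Yuniq; split.
  by apply/asboolP; exists Z'.
by move=> _ /asboolP[U AU <-]; apply: Z'min.
Qed.

Definition wsucc : woset := Woset succ_le_well_order.

End Successor.

(* [wsucc W] is the least ordinal of cardinality > |W|, see [wsucc_gt] and
   [wsucc_seg]. *)
Definition omega (k : nat) : woset := iter k wsucc omega0.

Definition aleph (k : nat) : set (omega k) := [set: omega k].
Arguments aleph : clear implicits.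

Section SuccessorFacts.
Variable W : woset.

Lemma wle_total (V : woset) (x y : V) : wle x y || wle y x.
Proof.
have [z [[z_in zmin] _]] :
    exists! z, minimum_of wle (fun z => `[< z = x \/ z = y >]) z.
  by apply: wleP; exists x; apply/asboolP; left.
have xz : wle z x by apply: zmin; apply/asboolP; left.
have yz : wle z y by apply: zmin; apply/asboolP; right.
by move/asboolP: z_in xz yz => [] -> ? ?; apply/orP; [left|right].
Qed.

Lemma wsucc_seg (X : wsucc W) : wseg X #<= [set: W].
Proof.
apply: (card_le_trans _ (proj2_sig X)); apply/card_leP/injfunPex.
pose h (u : set_type (wseg X)) : set_type (wseg (sval X)) :=
  SigSub (mem_set (set_mem (valP u) : wseg (sval X) (sval (val u)))).
exists h => // u v _ _ /(congr1 val) /= uv.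
by apply: val_inj; apply: sval_inj.
Qed.

Lemma wsucc_gt : ~~ ([set: wsucc W] #<= [set: W]).
Proof.
apply/negP => le_succ.
pose B : {pred powW W} := fun X => ~~ (wseg X #<= [set: W]).
have [exB|nB] := pselect (exists X, X \in B).
  have [X [[XB Xmin] _]] := @wleP (powW W) B exB.
  move/negP: XB; apply; apply: (card_le_trans _ le_succ).
  have small Y : wlt Y X -> wseg Y #<= [set: W].
    move=> /andP[_ nXY]; apply/negPn/negP => /Xmin XY.
    by rewrite XY in nXY.
  apply/card_leP/injfunPex.
  pose h (u : set_type (wseg X)) : set_type [set: wsucc W] :=
    SigSub (mem_set (I : [set: wsucc W]
                           (exist _ (val u) (small _ (set_mem (valP u)))))).
  exists h => // u v _ _ /(congr1 (sval \o val)) /= uv.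
  exact: val_inj.
have small (X : powW W) : wseg X #<= [set: W].
  by apply/negPn/negP => XB; apply: nB; exists X.
have {le_succ} le_pow : [set: set W] #<= [set: W].
  apply: (card_le_trans _ le_succ); apply/card_leP/injfunPex.
  pose h (u : set_type [set: set W]) : set_type [set: wsucc W] :=
    SigSub (mem_set (I : [set: wsucc W] (exist _ (val u) (small (val u))))).
  exists h => // u v _ _ /(congr1 (sval \o val)) /= uv.
  exact: val_inj.
have /card_leP/injfunPex[f _ finj] := le_pow.
pose g (X : set W) : W := val (f (SigSub (mem_set (I : [set: set W] X)))).
have ginj X Y : g X = g Y -> X = Y.
  move=> /val_inj/finj; rewrite !in_setT => /(_ isT isT).
  by move=> /(congr1 val).
pose D : set W := [set w | exists2 X, g X = w & ~ X w].
have nD : ~ D (g D) by move=> DD; have [X /ginj ->] := DD; apply.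
by apply: (nD); exists D.
Qed.

End SuccessorFacts.

(** * Cofinality, stationary sets, weak diamond *)

Definition cofinal_in T (R : T -> T -> Prop) (P A : set T) : Prop :=
  A `<=` P /\ forall x, P x -> exists2 a, A a & R x a.

(* The least cardinality of a cofinal subset of (P, R) is |B|. *)
Definition cofinality_is T U (R : T -> T -> Prop) (P : set T) (B : set U) :=
  (exists2 A, cofinal_in R P A & A #= B) /\
  (forall A, cofinal_in R P A -> B #<= A).

Definition Scof (k : nat) : set (omega k.+1) :=
  [set a | cofinality_is (fun x y => wle x y) (wseg a) (aleph k)].
Arguments Scof : clear implicits.

(* The first premise of the second clause excludes a = 0; if a is a successor,
   the second premise fails. *)
Definition club (W : woset) (D : set W) : Prop :=
  (forall x : W, exists2 c, D c & wlt x c) /\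
  (forall a : W, (exists x, wlt x a) ->
     (forall x, wlt x a -> exists c, [/\ D c, wlt x c & wlt c a]) -> D a).

Definition stationary (W : woset) (S : set W) : Prop :=
  forall D, club D -> S `&` D !=set0.

(* A function F : 2^{<W} -> 2, curried in the length l of its argument. *)
Definition weak_diamond (W : woset) (S : set W) : Prop :=
  forall F : forall l : W, (set_type (wseg l) -> bool) -> bool,
  exists g : W -> bool, forall b : W -> bool,
    stationary [set l | S l /\ g l = F l (fun x => b (val x))].

(** * Chains in omega^omega *)

Definition le_star (f g : nat -> nat) : Prop :=
  cofinite_set [set i | (f i <= g i)%N].

Definition wchain (W : woset) T (R : T -> T -> Prop) (C : set T) : Prop :=
  exists2 s : W -> T, set_bij [set: W] C s &
    forall a b : W, wle a b -> R (s a) (s b).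

Definition unbounded T (R : T -> T -> Prop) (C : set T) : Prop :=
  ~ exists h, forall f, C f -> R f h.

Lemma le_star_refl f : le_star f f.
Proof.
rewrite /le_star (_ : ~` _ = set0) //; apply/seteqP; split=> // i /=.
by rewrite leqnn.
Qed.

(** * The groups attached to f *)

Local Open Scope ring_scope.

Definition Idx (f : nat -> nat) : Type := {p : nat * nat | (p.2 < f p.1)%N}.

Section Groups.
Variable G : zmodType.

(* [Idx f -> G] is the product over i of the groups G^{f(i)}; the subgroup of
   functions of finite support is the direct sum. *)
Definition fin_supp f : {pred (Idx f -> G)} :=
  fun phi => `[< finite_set [set u | phi u != 0] >].

Lemma fin_supp_zmod_closed f : zmod_closed (@fin_supp f).
Proof.
split=> [|phi psi /asboolP fphi /asboolP fpsi]; apply/asboolP.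
  rewrite (_ : [set _ | _] = set0) //; apply/seteqP; split=> // u /=.
  by rewrite eqxx.
apply: (sub_finite_set _ (_ : finite_set (_ `|` _))); last first.
  by rewrite finite_setU; split; [exact: fphi | exact: fpsi].
move=> u /= nz; apply: contrapT => /not_orP[/negP/negPn/eqP e1 /negP/negPn/eqP e2].
by move: nz; rewrite /GRing.add /= /GRing.opp /= e1 e2 subr0 eqxx.
Qed.

HB.instance Definition _ f :=
  GRing.isZmodClosed.Build (Idx f -> G) (@fin_supp f) (@fin_supp_zmod_closed f).

(* Restriction to I_f of a function on I_g, extended by 0 on I_f \ I_g, which
   is empty when f <= g and finite when f <=* g. *)
Definition restr f g (phi : Idx g -> G) : Idx f -> G :=
  fun u => if insub (val u) is Some v then phi v else 0.
Arguments restr : clear implicits.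

Lemma restr_is_zmod_morphism f g : zmod_morphism (restr f g).
Proof.
move=> phi psi; apply/funext => u; rewrite /GRing.add /= /GRing.opp /= /restr.
by case: insub => // ; rewrite subr0.
Qed.

Lemma restr_id f phi : restr f f phi = phi.
Proof. by apply/funext => u; rewrite /restr valK. Qed.

Lemma restr_comp f g h phi : (f <= g)%O ->
  restr f g (restr g h phi) = restr f h phi.
Proof.
move=> /lefP fg; apply/funext => u; rewrite /restr.
have hu : ((val u).2 < g (val u).1)%N.
  by apply: (leq_trans (valP u)); have := fg (val u).1; rewrite leEnat.
by rewrite insubT.
Qed.

Lemma restr_fin_supp f g phi :
  phi \in @fin_supp g -> restr f g phi \in @fin_supp f.
Proof.
move=> /asboolP fphi; apply/asboolP.
have fval : finite_set [set val u | u in [set u | phi u != 0]].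
  exact: finite_image.
apply: (@sub_finite_set _ _ (val @^-1` _)); last first.
  by apply: (finite_preimage _ fval) => ? ? _ _; apply: val_inj.
by move=> u /=; rewrite /restr; case: insubP => [v _ uv nz|]; [exists v | rewrite eqxx].
Qed.

Definition Q f : zmodType := Quotient.quot (@fin_supp f).

Definition proj f g (x : Q g) : Q f := \pi_(Q f)%qT (restr f g (repr x)).
Arguments proj : clear implicits.

Lemma proj_pi f g phi :
  proj f g (\pi_(Q g)%qT phi) = \pi_(Q f)%qT (restr f g phi).
Proof.
apply/eqP; rewrite /proj -Quotient.idealrBE -restr_is_zmod_morphism.
by apply: restr_fin_supp; rewrite Quotient.idealrBE reprK.
Qed.

Lemma proj_id f x : proj f f x = x.
Proof. by rewrite /proj restr_id reprK. Qed.

Definition dsum f : Type := {phi : Idx f -> G | phi \in @fin_supp f}.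
HB.instance Definition _ f := Choice.on (dsum f).
HB.instance Definition _ f := SubChoice.on (dsum f).
HB.instance Definition _ f := [SubChoice_isSubZmodule of dsum f by <:].

Definition dsum_restr f g (x : dsum g) : dsum f :=
  exist _ (restr f g (val x)) (restr_fin_supp f (valP x)).
Arguments dsum_restr : clear implicits.

Lemma dsum_restr_is_zmod_morphism f g : zmod_morphism (dsum_restr f g).
Proof. by move=> x y; apply: val_inj; exact: restr_is_zmod_morphism. Qed.
HB.instance Definition _ f g :=
  GRing.isZmodMorphism.Build (dsum g) (dsum f) (dsum_restr f g)
    (@dsum_restr_is_zmod_morphism f g).

(** * Coherent families *)

(* The tuples f_0 <=* ... <=* f_m in P. *)
Record incr (P : set (nat -> nat)) (m : nat) := Incr {
  tup :> 'I_m.+1 -> nat -> nat;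
  tup_in : forall i, P (tup i);
  tup_le : forall i j : 'I_m.+1, (i <= j)%N -> le_star (tup i) (tup j)
}.

Lemma face_le P m (t : incr P m.+1) (k : 'I_m.+2) (i j : 'I_m.+1) :
  (i <= j)%N -> le_star (t (lift k i)) (t (lift k j)).
Proof. by move=> ij; apply: tup_le; rewrite leq_bump2. Qed.

(* The tuple t with its entry of index k removed. *)
Definition face P m (k : 'I_m.+2) (t : incr P m.+1) : incr P m :=
  @Incr P m (fun i => t (lift k i)) (fun i => tup_in t (lift k i))
    (@face_le P m t k).

Definition incr_sub (C P : set (nat -> nat)) (CP : C `<=` P) m (t : incr C m) :
    incr P m :=
  @Incr P m t (fun i => CP _ (tup_in t i)) (@tup_le C m t).

Definition K P m : Type := forall t : incr P m, Q (t ord0).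

(* [delta P m] is the map delta^{m+1} : K^m(P) -> K^{m+1}(P). For k > 0 the
   first entry of [face k t] is that of t and the projection is the identity
   (see [proj_id]); it only makes all the summands elements of [Q (t ord0)]. *)
Definition delta P m (x : K P m) : K P m.+1 :=
  fun t => \sum_(k < m.+2)
    proj (t ord0) (face k t ord0) (x (face k t)) *~ (-1) ^+ k.

(* Carrier of the n-coherent families on P, for n >= 1 (the value at n = 0 is
   not used). *)
Definition cfamily (n : nat) (P : set (nat -> nat)) : Type :=
  match n with
  | m.+2 => K P m.+1
  | _ => forall f, P f -> Idx f -> G
  end.

Definition coherent n P : cfamily n P -> Prop :=
  match n with
  | m.+2 => fun x : K P m.+1 => forall t, delta x t = 0
  | _ => fun phi : (forall f, P f -> Idx f -> G) =>
      forall f g (Pf : P f) (Pg : P g),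
        finite_set [set p : nat * nat |
          exists (pf : (p.2 < f p.1)%N) (pg : (p.2 < g p.1)%N),
            phi f Pf (exist _ p pf) <> phi g Pg (exist _ p pg)]
  end.

Definition nontrivial_on n P C (CP : C `<=` P) : cfamily n P -> Prop :=
  match n with
  | m.+2 => fun x : K P m.+1 =>
      ~ exists y : K C m, forall t, delta y t = x (incr_sub CP t)
  | _ => fun phi : (forall f, P f -> Idx f -> G) =>
      ~ exists psi : nat * nat -> G, forall f (Cf : C f),
          finite_set [set u : Idx f | psi (val u) <> phi f (CP f Cf) u]
  end.

End Groups.
Arguments restr {G} f g phi.
Arguments proj {G} f g x.
Arguments dsum_restr {G} f g x.

(** * Inverse systems and the derived functors of the inverse limit *)

Section InverseSystems.
Context {d : Order.disp_t} {T : porderType d}.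

Record invsys := InvSys {
  obj :> T -> zmodType;
  bond : forall i j : T, (i <= j)%O -> {additive obj j -> obj i};
  bond_id : forall i (ii : (i <= i)%O) x, bond ii x = x;
  bond_comp : forall i j k (ij : (i <= j)%O) (jk : (j <= k)%O)
    (ik : (i <= k)%O) x, bond ij (bond jk x) = bond ik x
}.

Record invmor (A B : invsys) := InvMor {
  mor_map :> forall i, {additive A i -> B i};
  mor_bond : forall i j (ij : (i <= j)%O) x,
    mor_map i (bond A ij x) = bond B ij (mor_map j x)
}.

Definition mono A B (m : invmor A B) : Prop := forall i, injective (m i).

Definition injective_sys (I : invsys) : Prop :=
  forall (A B : invsys) (m : invmor A B) (h : invmor A I), mono m ->
    exists h' : invmor B I, forall i x, h' i (m i x) = h i x.

Record inj_resolution (A : invsys) := InjResolution {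
  res : nat -> invsys;
  res_inj : forall k, injective_sys (res k);
  res_aug : invmor A (res 0);
  res_d : forall k, invmor (res k) (res k.+1);
  res_mono : mono res_aug;
  res_exact0 : forall i x,
    res_d 0 i x = 0 <-> exists a, res_aug i a = x;
  res_exact : forall k i x,
    res_d k.+1 i x = 0 <-> exists y, res_d k i y = x
}.

Definition invlim (A : invsys) : set (forall i, A i) :=
  [set x | forall i j (ij : (i <= j)%O), bond A ij (x j) = x i].

(* Cocycles and coboundaries of the complex lim I^0 -> lim I^1 -> ... *)
Definition cocycle A (R : inj_resolution A) n : set (forall i, res R n i) :=
  [set x | invlim x /\ forall i, res_d R n i (x i) = 0].
Arguments cocycle : clear implicits.

Definition coboundary A (R : inj_resolution A) n :
    set (forall i, res R n i) :=
  match n with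
  | 0 => [set x | forall i, x i = 0]
  | m.+1 => [set x | exists2 y, invlim y & forall i, x i = res_d R m i (y i)]
  end.
Arguments coboundary : clear implicits.

(* lim^n A <> 0: lim^n A is H^n(lim I) for any injective resolution I of A,
   and the first conjunct prevents the quantification from being vacuous. *)
Definition lim_derived_neq0 (n : nat) (A : invsys) : Prop :=
  inhabited (inj_resolution A) /\
  forall R : inj_resolution A, exists x, cocycle A R n x /\ ~ coboundary A R n x.

End InverseSystems.
Arguments invsys {d} T.

Section SystemA.
Variable G : zmodType.

Lemma dsum_restr_id (f : nat -> nat) (ff : (f <= f)%O) (x : dsum G f) :
  dsum_restr f f x = x.
Proof. by apply: val_inj; exact: restr_id. Qed.

Lemma dsum_restr_comp (f g h : nat -> nat) (fg : (f <= g)%O) (gh : (g <= h)%O)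
    (fh : (f <= h)%O) (x : dsum G h) :
  dsum_restr f g (dsum_restr g h x) = dsum_restr f h x.
Proof. by apply: val_inj; exact: restr_comp. Qed.

(* The order on [nat -> nat] is the pointwise one, see [lefP]. *)
Definition sysA : invsys (nat -> nat) :=
  @InvSys _ (nat -> nat) (fun f => dsum G f)
    (fun f g _ => dsum_restr f g) dsum_restr_id dsum_restr_comp.

End SystemA.

(* Main.v *)
(* A family on a set P of functions is treated as a cochain of tuples of P with
   values in the quotients E / S_f, where E = G^(omega x omega) and S_f consists
   of the functions of finite support on I_f; as all coefficients live in E, the
   coboundary is an alternating sum in E, and n = 1 is the case of the augmented
   complex.

   Cocycles on (m+1)-tuples from an ideal of (omega^omega, <=* ) generated by
   aleph_k <= aleph_m functions are coboundaries (Goblot).  So along a filtration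
   by omega_n of omega^omega (n = k + 1) one builds an n-cocycle x^b for each
   b : omega_n -> 2: at stage a choose a primitive y of x^b restricted to the ideal
   P_a generated so far, add b(a) z, and extend by zero, where z is an
   (n-1)-cocycle on P_a which is nontrivial on the chain below a.  For cof(a) =
   omega_(n-1) such a z exists by induction on n, since the chain is unbounded in
   P_a for club many a.  A primitive w of x^b on the chain determines, below a, the
   class of y + b(a) z, hence the bit b(a); weak diamond guesses this bit from
   b and w below a, and b can be chosen to contradict the guess.  To code w by
   bits the nontriviality is tested after a map G -> Q/Z which does not kill a
   given g <> 0.

   If lim^n A vanished, the cocycle delta x with values in A would be a
   coboundary on the tuples increasing for the pointwise order (dimension shifting
   along an injective resolution), so x would be a coboundary on these tuples, and
   then also on the <=*-increasing ones, the pointwise order being cofinal. *)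

Require Import Defs.
From HB Require Import structures.
From Stdlib Require Import Wellfounded.Lexicographic_Product Relations.Relation_Operators.
From mathcomp Require Import all_boot all_order all_algebra.
From mathcomp Require Import ring_quotient generic_quotient.
From mathcomp Require Import all_classical.

Set Implicit Arguments.
Unset Strict Implicit.
Unset Printing Implicit Defensive.

Import Order.TTheory GRing.Theory Num.Theory.

Local Open Scope classical_set_scope.
Local Open Scope card_scope.

(** * Tuples *)

Section Tuples.
Variable U : Type.
Implicit Types (P Q : U -> Prop) (R : U -> U -> Prop) (s t : seq U).

Fixpoint All P s : Prop := if s is a :: s' then P a /\ All P s' else True.

(** All pairs are compared, not only consecutive ones, so sortedness passes to faces without
    transitivity of [R]. *)
Fixpoint Srt R s : Prop := if s is a :: s' then All (R a) s' /\ Srt R s' else True.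

Fixpoint drop1 s t : Prop :=
  match s with
  | [::] => False
  | a :: s' => t = s' \/ exists2 t', drop1 s' t' & t = a :: t'
  end.

Lemma All_imp P Q s : (forall a, P a -> Q a) -> All P s -> All Q s.
Proof. by move=> PQ; elim: s => //= a s IH [/PQ ? /IH]. Qed.

Lemma All_and P Q s : All P s -> All Q s -> All (fun a => P a /\ Q a) s.
Proof. by elim: s => //= a s IH [? /IH H] [? /H]. Qed.

Lemma All_true P s : (forall a, P a) -> All P s.
Proof. by move=> H; elim: s => //=. Qed.

Lemma All_rcons P s a : All P (rcons s a) <-> All P s /\ P a.
Proof. by elim: s => [|b s IH] /=; [tauto | rewrite IH; tauto]. Qed.

Lemma Srt_rcons R s a : Srt R (rcons s a) <-> Srt R s /\ All (R^~ a) s.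
Proof. by elim: s => [|b s IH] /=; [tauto | rewrite IH All_rcons; tauto]. Qed.

Lemma Srt_sub R R' s : (forall a b, R a b -> R' a b) -> Srt R s -> Srt R' s.
Proof.
by move=> RR'; elim: s => //= a s IH [Ra /IH ?]; split=> //; apply: All_imp Ra => b; exact: RR'.
Qed.

Lemma drop1_All P s t : drop1 s t -> All P s -> All P t.
Proof.
elim: s t => //= a s IH t [-> []//|[t' /IH st' ->] [Pa Ps] /=]; split=> //; exact: st'.
Qed.

Lemma drop1_Srt R s t : drop1 s t -> Srt R s -> Srt R t.
Proof.
elim: s t => //= a s IH t [-> []//|[t' st' ->] [Ra Rs] /=]; split; last exact: IH.
exact: drop1_All Ra.
Qed.

Lemma drop1_size s t : drop1 s t -> size s = (size t).+1.
Proof. by elim: s t => //= a s IH t [->//|[t' /IH -> ->]]. Qed.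

(** Values at a face live in the quotient at its own first entry; this comparison lets them be read
    at the first entry of the whole tuple. *)
Lemma drop1_head R a s b t : (forall a, R a a) -> Srt R (a :: s) ->
  drop1 (a :: s) (b :: t) -> R a b.
Proof. by move=> Rxx [Ra _] /= [E|[t' _ [-> _]]] //; move: Ra; rewrite -E => -[]. Qed.

End Tuples.

Lemma All_map U V (g : U -> V) P s : All P (map g s) <-> All (fun a => P (g a)) s.
Proof. by elim: s => //= a s ->. Qed.

Lemma Srt_map U V (g : U -> V) R s :
  Srt R (map g s) <-> Srt (fun a b => R (g a) (g b)) s.
Proof. by elim: s => //= a s ->; rewrite All_map. Qed.

(** * Well-orders and cardinals *)

Section Wosets.
Variable W : woset.
Implicit Types (x y z : W) (P : W -> Prop).

Lemma wle_min P : (exists x, P x) -> exists2 x, P x & forall y, P y -> wle x y.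
Proof.
move=> [x Px]; have [|m [[mP mmin] _]] := @wleP W (fun z => `[< P z >]).
  by exists x; apply/asboolP.
by exists m => [|y Py]; [apply/asboolP | apply: mmin; apply/asboolP].
Qed.

Lemma wle_refl x : wle x x.
Proof. by have := wle_total x x; rewrite orbb. Qed.

Lemma wle_anti x y : wle x y -> wle y x -> x = y.
Proof.
move=> xy yx; have [|m [_ muniq]] := @wleP W (fun z => `[< z = x \/ z = y >]).
  by exists x; apply/asboolP; left.
rewrite -(muniq x) ?(muniq y)//; split.
- by apply/asboolP; right.
- by move=> z /asboolP[->|->] //; exact: wle_refl.
- by apply/asboolP; left.
- by move=> z /asboolP[->|->] //; exact: wle_refl.
Qed.

Lemma wle_trans y x z : wle x y -> wle y z -> wle x z.
Proof.
move=> xy twisted; have [|m [->|[->|->]] mmin] := @wle_min (fun u => u = x \/ u = y \/ u = z).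
- by exists x; left.
- by apply: mmin; right; right.
- by rewrite (wle_anti xy (mmin x (or_introl erefl))).
- by rewrite -(wle_anti twisted (mmin y (or_intror (or_introl erefl)))).
Qed.

Lemma wltNge x y : wlt x y = ~~ wle y x.
Proof. by rewrite /wlt; have := wle_total x y; case: (wle y x) => //=;
  rewrite ?andbF ?orbF ?andbT. Qed.

Lemma wleNgt x y : wle x y = ~~ wlt y x.
Proof. by rewrite wltNge negbK. Qed.

Lemma wltW x y : wlt x y -> wle x y.
Proof. by case/andP. Qed.

Lemma wlt_le_trans y x z : wlt x y -> wle y z -> wlt x z.
Proof. by rewrite !wltNge => xy twisted; apply: contra xy => zx; apply: wle_trans zx. Qed.

Lemma wle_lt_trans y x z : wle x y -> wlt y z -> wlt x z.
Proof. by rewrite !wltNge => xy twisted; apply: contra twisted => zx; apply: wle_trans xy. Qed.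

Lemma wlt_trans y x z : wlt x y -> wlt y z -> wlt x z.
Proof. by move=> /wltW; apply: wle_lt_trans. Qed.

Lemma wle_eqVlt x y : wle x y -> x = y \/ wlt x y.
Proof.
by move=> xy; have [yx|yx] := boolP (wle y x); [left; apply: wle_anti | right; rewrite wltNge].
Qed.

Lemma wlt_wf : well_founded (fun x y => wlt x y).
Proof.
move=> x; apply: contrapT => nx.
have [m nm mmin] := wle_min (ex_intro (fun x => ~ Acc _ x) x nx).
apply: nm; constructor => y ym; apply: contrapT => /mmin.
by rewrite wleNgt ym.
Qed.

Lemma wlt_ind P : (forall x, (forall y, wlt y x -> P y) -> P x) -> forall x, P x.
Proof. by move=> H x; elim: (wlt_wf x) => y _ IH; apply: H. Qed.

Lemma wmax (s : seq W) (P : W -> Prop) : s <> [::] -> All P s ->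
  exists2 m, P m & All (fun x => wle x m) s.
Proof.
elim: s => // a [|b s] IH _ [Pa Ps]; first by exists a => //=; split=> //; exact: wle_refl.
have [//|//|m Pm sm] := IH.
have /orP[am|ma] := wle_total a m; [by exists m | exists a => //].
split; first exact: wle_refl.
by apply: All_imp sm => x xm; apply: wle_trans ma.
Qed.

(** * Recursion along a rank with values in a well-order *)

Section Recursion.
Variables (X Y : Type) (rk : X -> W) (y0 : Y).

Definition trunc x (f : X -> Y) : X -> Y := fun s => if wlt (rk s) x then f s else y0.

Definition recursive (Phi : W -> (X -> Y) -> X -> Y) (f : X -> Y) :=
  forall s, f s = Phi (rk s) (trunc (rk s) f) s.

Lemma recursive_ex Phi : exists f, recursive Phi f.
Proof.
pose step x (f : forall z, wlt z x -> X -> Y) : X -> Y :=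
  Phi x (fun s => match pselect (wlt (rk s) x) with
         | left h => f _ h s | right _ => y0 end).
pose F := Fix wlt_wf (fun=> X -> Y) step.
have FE x : F x = step x (fun z _ => F z).
  apply: (Fix_eq wlt_wf (fun=> X -> Y) step) => {}x f g fg.
  rewrite /step; congr Phi; apply/funext => s; case: pselect => // h.
  by rewrite fg.
exists (fun s => F (rk s) s) => s.
rewrite FE /step; congr Phi; apply/funext => t; rewrite /trunc.
by case: pselect => [->//|/negP/negPf->].
Qed.

(** Makes a branch of the construction, up to a stage, a function of the bits before that stage. *)
Lemma recursive_uniq Phi Phi' f f' x : recursive Phi f -> recursive Phi' f' ->
  (forall z, wlt z x -> Phi z = Phi' z) -> trunc x f = trunc x f'.
Proof.
move=> Ry Ry' PP.
suff H z : wlt z x -> forall s, rk s = z -> f s = f' s.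
  by apply/funext => s; rewrite /trunc; case: ifP => // /H; apply.
elim/wlt_ind: z => z IH zx s sz; rewrite Ry Ry' sz PP//; congr Phi'.
apply/funext => t; rewrite /trunc; case: ifP => // tz.
by apply: (IH (rk t)) => //; apply: wlt_trans zx.
Qed.

End Recursion.
End Wosets.

(** * Comparison of cardinalities *)

Definition emb (A B : Type) := exists f : A -> B, injective f.

Definition into (T U : Type) (A : T -> Prop) := exists f : T -> U,
  forall x y, A x -> A y -> f x = f y -> x = y.
Arguments into {T} U A.

(** Closure under pairing is part of the notion and is proved for each [omega k] by induction, in
    place of a general theorem on cardinal squares. *)
Definition infinite_card (V : Type) := emb (V * V) V /\ emb nat V.

Lemma card_into T V (A : set T) : inhabited V -> A #<= [set: V] -> into V A.
Proof.
move=> [v0] /card_leP/injfunPex[f _ finj].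
pose g t := match pselect (A t) with
  | left h => val (f (SigSub (mem_set h))) | right _ => v0 end.
exists g => x y Ax Ay; rewrite /g.
case: pselect => // hx; case: pselect => // hy /val_inj /finj.
by rewrite !in_setT => /(_ isT isT) /(congr1 val).
Qed.

Lemma into_card T V (A : set T) : into V A -> A #<= [set: V].
Proof.
move=> [f finj]; apply/card_leP/injfunPex.
exists (fun u : set_type A => SigSub (mem_set (I : [set: V] (f (val u))))) => //.
move=> u v _ _ /(congr1 val) /= E; apply: val_inj.
by apply: finj E; [exact: set_mem (valP u) | exact: set_mem (valP v)].
Qed.

Lemma into_sub T V (A B : T -> Prop) : (forall x, A x -> B x) -> into V B -> into V A.
Proof. by move=> AB [f H]; exists f => x y /AB ? /AB; apply: H. Qed.

Lemma into_T U V : emb U V -> into V (fun _ : U => True).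
Proof. by move=> [f fi]; exists f => x y _ _; apply: fi. Qed.

Lemma into_fibers T I V (A : T -> Prop) (m : T -> I) : emb (I * V) V ->
  (forall i, into V (fun x => A x /\ m x = i)) -> into V A.
Proof.
move=> [p pinj] /choice[f fi]; exists (fun x => p (m x, f (m x) x)) => x y Ax Ay /pinj[mxy fxy].
by apply: (fi (m x)) => //; rewrite fxy mxy.
Qed.

Lemma emb_trans A B C : emb A B -> emb B C -> emb A C.
Proof. by move=> [f fi] [g gi]; exists (g \o f); apply: inj_comp. Qed.

Section InfiniteCard.
Variable V : Type.
Hypothesis Vinf : infinite_card V.

Lemma into_setX T T' (A : T -> Prop) (B : T' -> Prop) :
  into V A -> into V B -> into V (fun p => A p.1 /\ B p.2).
Proof.
have [[p pi] _] := Vinf; move=> [f fi] [g gi].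
exists (fun z => p (f z.1, g z.2)) => -[x y] [x' y'] /= [Ax By] [Ax' By'] /pi[/fi -> // /gi -> //].
Qed.

(** A list is coded by its length and an iterated pairing; the length makes the arbitrary code [i 0]
    of the empty list harmless. *)
Lemma into_seq T (A : T -> Prop) : into V A -> into V (fun s => All A s).
Proof.
have [[p pi] [i ii]] := Vinf; move=> [f fi].
pose fix c s := if s is a :: s' then p (f a, c s') else i 0.
exists (fun s => p (i (size s), c s)) => s t As At /pi[/ii].
elim: s t As At => [|a s IH] [|b t] //= [Aa As] [Ab At] [st] /pi[fab cst].
by rewrite (fi a b)// (IH t).
Qed.

Lemma into_seq_nat T (A : T -> Prop) : into V A ->
  into V (fun z : seq T * nat => All A z.1).
Proof.
move=> /into_seq As; have [_ nV] := Vinf; have := into_setX As (into_T nV).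
by apply: into_sub => z.
Qed.

Lemma into_add1 T (A : T -> Prop) x0 : into V A -> into V (fun x => A x \/ x = x0).
Proof.
have [[p pi] [i ii]] := Vinf; move=> [f fi].
exists (fun x => if `[< x = x0 >] then p (i 1, i 1) else p (i 0, f x)) => x y Ax Ay.
case: asboolP => [->|xx0]; case: asboolP => [->//|yx0] /pi [].
- by move=> /ii.
- by move=> /ii.
by case: Ax => // Ax; case: Ay => // Ay; apply: fi.
Qed.

Lemma into_pair T (A B : T -> Prop) : into V A -> into V B -> into V (fun x => A x \/ B x).
Proof.
have [[p pi] [i ii]] := Vinf; move=> [f fi] [g gi].
exists (fun x => if `[< A x >] then p (i 0, f x) else p (i 1, g x)) => x y Ax Ay.
case: asboolP => [a|a]; case: asboolP => [b|b] /pi [].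
- exact: fi.
- by move=> /ii.
- by move=> /ii.
by apply: gi; tauto.
Qed.

End InfiniteCard.

Lemma infinite_card_nat : infinite_card nat.
Proof.
split; last by exists id.
by exists pickle; apply: (can_inj (g := odflt (0, 0) \o unpickle)) => x /=; rewrite pickleK.
Qed.

(** * Arithmetic and regularity of the successor cardinal *)

Section Succ.
Variable V : woset.
Hypothesis Vinf : infinite_card V.
Let W := wsucc V.

Let inhV : inhabited V. Proof. by have [_ [i _]] := Vinf; split; exact: (i 0). Qed.

Lemma succ_notinto : ~ emb W V.
Proof. by move=> /into_T /into_card H; have /negP := wsucc_gt V; apply. Qed.

Lemma seg_into (x : W) : into V (fun y => wlt y x).
Proof. by have := @wsucc_seg V x; exact: card_into. Qed.

Lemma segle_into (x : W) : into V (fun y => wle y x).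
Proof.
by apply: into_sub (into_add1 Vinf x (seg_into x)) => y /wle_eqVlt; tauto.
Qed.

(** Greedy recursion: the predecessors of [z] occupy at most |V| values, and since [W] does not
    embed in [V] one is still free. *)
Lemma emb_succ Z (lt : Z -> Z -> Prop) : well_founded lt ->
  (forall z z', z <> z' -> lt z z' \/ lt z' z) ->
  (forall z, into V (fun z' => lt z' z)) -> emb Z W.
Proof.
move=> wf tot seg; have [v0] := inhV.
have fresh z (f : Z -> W) : exists w, forall z', lt z' z -> f z' <> w.
  apply: contrapT => /forallNP H; apply: succ_notinto.
  have /choice[g gP] : forall w, exists z', lt z' z /\ f z' = w.
    move=> w; have := H w; apply: contra_notP => /forallNP K z' lz E.
    by apply: (K z').
  have [h hi] := seg z.
  exists (h \o g) => w w' /= /hi E.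
  by rewrite -(proj2 (gP w)) -(proj2 (gP w')) E//; apply: proj1; exact: gP.
pose fr (z : Z) (f : Z -> W) : W := projT1 (cid (fresh z f)).
have [w0] : inhabited W.
  by apply: contrapT => nW; apply: succ_notinto; exists (fun=> v0) => w; case: nW.
pose step z (f : forall z', lt z' z -> W) : W :=
  fr z (fun z' => match pselect (lt z' z) with left h => f _ h | right _ => w0 end).
pose F := Fix wf (fun=> W) step.
have FE z : F z = step z (fun z' _ => F z').
  apply: (Fix_eq wf (fun=> W) step) => {}z f g fg.
  rewrite /step; congr fr; apply/funext => s; case: pselect => // h.
have Flt z z' : lt z' z -> F z' <> F z.
  move=> lz; rewrite (FE z) /step /fr; case: cid => w /= /(_ _ lz).
  by case: pselect.
exists F => z z' E; apply: contrapT => /tot[] /Flt; by rewrite E.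
Qed.

Lemma emb_succ_pair : emb (W * V) W.
Proof.
apply: (emb_succ (wf_slexprod _ _ _ _ (@wlt_wf W) (@wlt_wf V))).
- move=> [w v] [w' v'] ne.
  have /orP[/wle_eqVlt[E|lt]|/wle_eqVlt[E|lt]] := wle_total w w'.
  + rewrite -E in ne *; have /orP[/wle_eqVlt[F|lt]|/wle_eqVlt[F|lt]] := wle_total v v'.
    * by case: ne; rewrite F.
    * by left; apply: right_slex.
    * by case: ne; rewrite F.
    * by right; apply: right_slex.
  + by left; apply: left_slex.
  + rewrite E in ne *; have /orP[/wle_eqVlt[F|lt]|/wle_eqVlt[F|lt]] := wle_total v v'.
    * by case: ne; rewrite F.
    * by left; apply: right_slex.
    * by case: ne; rewrite F.
    * by right; apply: right_slex.
  + by right; apply: left_slex.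
move=> [w v]; apply: (into_sub (B := fun p => wle p.1 w /\ True)).
  move=> [w' v'] H; split=> //=; inversion_clear H; [exact: wltW | exact: wle_refl].
have vT : into V (fun _ : V => True) by apply: into_T; exists id.
by have := into_setX Vinf (segle_into w) vT.
Qed.

Lemma emb_base_succ : emb V W.
Proof.
have [v0] := inhV; have [p pinj] := emb_succ_pair; have [f fi] := proj2 Vinf.
have [w0] : inhabited W.
  by apply: contrapT => nW; apply: succ_notinto; exists (fun=> v0) => w; case: nW.
by exists (fun v => p (w0, v)) => v v' /pinj[].
Qed.

Lemma into_succ_fibers T (A : T -> Prop) (m : T -> W) :
  (forall w, into V (fun x => A x /\ m x = w)) -> into W A.
Proof.
have [p pinj] := emb_succ_pair.
move=> /choice[f fi]; exists (fun x => p (m x, f (m x) x)) => x y Ax Ay /pinj[mxy fxy].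
by apply: (fi (m x)) => //; rewrite fxy mxy.
Qed.

(** The pairs with a given maximum lie in the square of a closed segment, so [W * W] splits into |W|
    fibres of size at most |V|. *)
Lemma infinite_succ : infinite_card W.
Proof.
split; last exact: emb_trans (proj2 Vinf) emb_base_succ.
have : into W (fun _ : W * W => True).
  apply: (into_succ_fibers (m := fun p => if wle p.1 p.2 then p.2 else p.1)) => w.
  apply: into_sub (into_setX Vinf (segle_into w) (segle_into w)) => -[a b] /= [_].
  case: ifP => [ab <-|/negbT ab <-]; split=> //; try exact: wle_refl.
  by apply: wltW; rewrite wltNge.
by case=> f fi; exists f => x y; apply: fi.
Qed.

Lemma succ_inh : inhabited W.
Proof. by have [_ [i _]] := infinite_succ; split; exact: (i 0). Qed.

(** If [g] were unbounded on [A], choosing for each [w] some [t w] in [A] with [w] at most [g (t w)]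
    would split [W] into |V| fibres, each inside a closed segment, and [W] would embed in [V]. *)
Lemma succ_regular T (A : T -> Prop) (g : T -> W) : into V A ->
  exists w, forall t, A t -> wlt (g t) w.
Proof.
move=> [h hi]; apply: contrapT => /forallNP H; apply: succ_notinto.
have /choice[t tP] : forall w, exists t, A t /\ wle w (g t).
  move=> w; have := H w; apply: contra_notP => /forallNP K t At.
  by rewrite wltNge; apply/negP => wt; apply: (K t).
have : into V (fun _ : W => True).
  apply: (into_fibers (m := fun w => h (t w)) (proj1 Vinf)) => v.
  have [[w0 w0v]|nv] := pselect (exists w, h (t w) = v).
    apply: into_sub (segle_into (g (t w0))) => w [_ wv].
    have [Aw wg] := tP w; have [A0 _] := tP w0.
    by rewrite (hi _ _ A0 Aw) // w0v.
  have [v0] := inhV; exists (fun=> v0) => x y [_ xv]; case: nv; by exists x.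
by case=> f fi; exists f => x y; apply: fi.
Qed.

Lemma succ_nomax (x : W) : exists y, wlt x y.
Proof.
have [v0] := inhV; have [y xy] := @succ_regular V (fun=> True) (fun=> x) (into_T (ex_intro _ id
  (fun _ _ => id))).
by exists y; apply: (xy v0).
Qed.

(** * Clubs of closure points *)

Definition closed_under (phi : seq W * nat -> W) (l : W) :=
  (exists x, wlt x l) /\
  forall a k, All (fun x => wlt x l) a -> wlt (phi (a, k)) l.

(** For unboundedness, iterate countably often a map sending [w] above all values of [phi] at
    sequences bounded by [w]. A finite sequence below the supremum lies below one of the
    iterates. *)
Lemma club_closed phi : club (closed_under phi).
Proof.
split.
  move=> x.
  have /choice[h hP] : forall w, exists w',
      wlt w w' /\ forall z, All (fun y => wle y w) z.1 -> wlt (phi z) w'.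
    move=> w; have [w1 H1] := succ_regular phi (into_seq_nat Vinf (segle_into w)).
    have [w2 H2] := succ_nomax w.
    have /orP[le|le] := wle_total w1 w2.
      by exists w2; split=> // z /H1 lt; apply: wlt_le_trans le.
    by exists w1; split=> //; apply: wlt_le_trans le.
  pose b := fun i : nat => iter i h x.
  have bub : exists l, forall i, wlt (b i) l.
    have [l lP] := succ_regular b (into_T (proj2 Vinf)); by exists l => i; apply: lP.
  have [l lP lmin] := wle_min bub.
  have ltl y : wlt y l -> exists i, wle y (b i).
    move=> yl; apply: contrapT => /forallNP H.
    have /lmin : forall i, wlt (b i) y by move=> i; rewrite wltNge; apply/negP.
    by rewrite wleNgt yl.
  have bmono i j : (i <= j)%N -> wle (b i) (b j).
    move=> /subnK <-; elim: (j - i)%N => [|k IH]; first exact: wle_refl.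
    by apply: wle_trans IH _; rewrite addSn /b iterS; apply: wltW; apply: (proj1 (hP _)).
  exists l; last exact: (lP 0).
  split; first by exists x; exact: (lP 0).
  move=> a k al.
  have [i ai] : exists i, All (fun y => wle y (b i)) a.
    elim: a al => [|c a IH] /=; first by exists 0.
    move=> [/ltl[i ci] /IH[j aj]]; exists (maxn i j); split.
      by apply: wle_trans ci _; apply: bmono; apply: leq_maxl.
    by apply: All_imp aj => d dj; apply: wle_trans dj _; apply: bmono; apply: leq_maxr.
  apply: wlt_trans (lP i.+1); rewrite /b iterS.
  exact: (proj2 (hP (b i)) (a, k) ai).
move=> l [x xl] H; split; first by exists x.
(* The empty sequence has no maximum; any point of the set below [l] serves instead. *)
move=> [|a0 a'] k al.
  by have [c [[_ /(_ [::] k I) Dc] _ cl]] := H _ xl; apply: wlt_trans cl.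
have [//|m ml am] := wmax _ al.
have [c [[_ Dc] mc cl]] := H _ ml; apply: wlt_trans cl; apply: Dc.
by apply: All_imp am => y ym; apply: wle_lt_trans mc.
Qed.

End Succ.

Lemma infinite_omega k : infinite_card (omega k).
Proof. by elim: k => [|k IH]; [exact: infinite_card_nat | exact: infinite_succ]. Qed.

Lemma omega_inh k : inhabited (omega k).
Proof. by have [_ [i _]] := infinite_omega k; split; exact: (i 0). Qed.

(** [omega k] is an initial ordinal: by counting for [k = 0], otherwise because closed segments
    embed in the previous cardinal. *)
Lemma seg_notinto k (i : omega k) (f : omega k -> omega k) :
  injective f -> ~ forall j, wle (f j) i.
Proof.
case: k i f => [|k] i f fi H.
  have /(uniq_leq_size (s2 := iota 0 i.+1)) : uniq [seq f j | j <- iota 0 i.+2].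
    by rewrite map_inj_uniq// iota_uniq.
  rewrite size_map !size_iota ltnn => K; have : false; last by [].
  apply: K => x /mapP[j _ ->]; rewrite mem_iota ltnS; exact: H.
have [h hi] := segle_into (infinite_omega k) i.
apply: (@succ_notinto (omega k)); exists (fun x => h (f x)) => x y.
by move=> /hi E; apply: fi; apply: E.
Qed.

(** [q i] is the least bound below [l] of those elements of a small cofinal set [A] whose index is
    at most [i]. *)
Lemma Scof_cofinal k (l : omega k.+1) : Scof k l ->
  exists q : omega k -> omega k.+1, [/\ forall i j, wle i j -> wle (q i) (q j),
    forall i, wlt (q i) l & forall x, wlt x l -> exists i, wle x (q i)].
Proof.
move=> [[A [Al Acof] /card_eqPle[Ak kA]] minl].
have [g gi] := card_into (omega_inh k) Ak.
have [w0] := succ_inh (infinite_omega k).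
(* Were these elements cofinal in [l], minimality of the cofinality would inject [omega k] into the
   closed segment of [i]. *)
have up (i : omega k) : exists x, wlt x l /\ forall y, A y -> wle (g y) i -> wle y x.
  pose B : set (omega k.+1) := [set y | A y /\ wle (g y) i].
  have /existsNP[x /not_implyP[xl xB]] : ~ forall x, wlt x l -> exists2 a, B a & wle x a.
    move=> Bcof; have /minl : cofinal_in (fun x y => wle x y) (wseg l) B.
      by split=> // y [/Al].
    move=> /card_leP/injfunPex[f _ fi].
    pose f' (j : omega k) : omega k.+1 := val (f (SigSub (mem_set (I : aleph k j)))).
    have f'B j : B (f' j) by apply: set_mem; exact: valP.
    have f'inj : injective f'.
      move=> x y /val_inj /fi; rewrite !in_setT => /(_ isT isT) /(congr1 val) //.
    apply: (@seg_notinto k i (g \o f')) => [x y /= /gi E|j /=].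
      by apply: f'inj; apply: E; apply: (proj1 (f'B _)).
    exact: (proj2 (f'B j)).
  exists x; split=> // y Ay gy; apply: contrapT => /negP yx; apply: xB; exists y => //.
  by apply: wltW; rewrite wltNge.
pose P (i : omega k) := fun x => wlt x l /\ forall y, A y -> wle (g y) i -> wle y x.
have /choice[q qP] : forall i, exists x, P i x /\ forall y, P i y -> wle x y.
  by move=> i; have [x Px xmin] := wle_min (up i); exists x.
exists q; split=> [i j ij|i|x xl].
- apply: (proj2 (qP i)); have [[ql qA] _] := qP j; split=> // y Ay gy.
  by apply: qA => //; apply: wle_trans ij.
- by have [[]] := qP i.
have [a Aa xa] := Acof _ xl; exists (g a); apply: wle_trans xa _.
by have [[_ qA] _] := qP (g a); apply: qA => //; apply: wle_refl.
Qed.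

Local Open Scope ring_scope.

(** * Cochains *)

Lemma subrACA (E : zmodType) (x y z w : E) : x - y - (z - w) = x - z - (y - w).
Proof. by rewrite !opprD !opprK addrACA. Qed.

Section Coboundary.
Variables (U : Type) (E : zmodType).
Implicit Types (x y : seq U -> E) (s t : seq U).

(** The alternating sum over all faces, the one without the head having sign +. On one-entry lists
    it is the augmentation [x [::]]. *)
Fixpoint cobd x s : E :=
  if s is a :: s' then x s' - cobd (fun t => x (a :: t)) s' else 0.

Lemma cobd_zmod x y s : cobd (fun t => x t - y t) s = cobd x s - cobd y s.
Proof.
elim: s x y => [|a s IH] x y /=; first by rewrite subr0.
by rewrite IH !opprD !opprK addrACA [- y s + _]addrC.
Qed.

Lemma cobd0 s : cobd (fun=> 0) s = 0.
Proof. by elim: s => //= a s ->; rewrite subr0. Qed.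

Lemma cobdN x s : cobd (fun t => - x t) s = - cobd x s.
Proof.
by have := cobd_zmod (fun=> 0) x s; rewrite cobd0 sub0r => <-; congr cobd; apply/funext=> t;
  rewrite sub0r.
Qed.

Lemma cobdD x y s : cobd (fun t => x t + y t) s = cobd x s + cobd y s.
Proof.
have := cobd_zmod x (fun t => - y t) s; rewrite cobdN opprK => <-; congr cobd.
by apply/funext => t; rewrite opprK.
Qed.

Lemma cobdMz x k s : cobd (fun t => x t *~ k) s = cobd x s *~ k.
Proof. by elim: s x => [|a s IH] x /=; [rewrite mul0rz | rewrite IH mulrzBl]. Qed.

Lemma cobdK x s : cobd (cobd x) s = 0.
Proof.
elim: s x => //= a s IH x; rewrite cobd_zmod IH subr0.
by rewrite subrr.
Qed.

Lemma cobd_rcons x s a :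
  cobd x (rcons s a) = cobd (fun t => x (rcons t a)) s + x s *~ (-1) ^+ size s.
Proof.
elim: s x => [|b s IH] x /=; first by rewrite subr0 add0r.
by rewrite IH opprD addrA exprS mulN1r mulrNz.
Qed.

Lemma cobd_ind (S : E -> Prop) x s : S 0 -> (forall a b, S a -> S b -> S (a - b)) ->
  (forall t, drop1 s t -> S (x t)) -> S (cobd x s).
Proof.
move=> S0 SB; elim: s x => //= a s IH x H; apply: SB; first by apply: H; left.
by apply: IH => t st; apply: H; right; exists t.
Qed.

Lemma eq_cobd x y s : (forall t, drop1 s t -> x t = y t) -> cobd x s = cobd y s.
Proof.
move=> H; apply/eqP; rewrite -subr_eq0 -cobd_zmod; apply/eqP.
by apply: (@cobd_ind (fun e => e = 0)) => [//|a b -> ->|t /H ->]; rewrite subrr.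
Qed.

End Coboundary.

Lemma cobd_map U V (E : zmodType) (g : U -> V) (x : seq V -> E) s :
  cobd x (map g s) = cobd (x \o map g) s.
Proof. by elim: s x => //= a s IH x; rewrite IH. Qed.

Lemma cobd_morph U (E E' : zmodType) (h : {additive E -> E'}) (x : seq U -> E) s :
  h (cobd x s) = cobd (h \o x) s.
Proof. by elim: s x => [|a s IH] x /=; [exact: raddf0 | rewrite raddfB IH]. Qed.

(* The system [U -> E / S f] of quotients of a fixed group, with projections
   for bonding maps; [R f g -> S g <= S f]. *)
Section QuotientSystems.
Variables (U : Type).
Implicit Types (R : U -> U -> Prop) (T : U -> Prop).

Definition subgroup (E : zmodType) (S : E -> Prop) :=
  S 0 /\ forall a b, S a -> S b -> S (a - b).

Lemma subgroupN (E : zmodType) (S : E -> Prop) a : subgroup S -> S a -> S (- a).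
Proof. by case=> S0 SB Sa; rewrite -sub0r; exact: SB. Qed.

Lemma subgroupD (E : zmodType) (S : E -> Prop) a b :
  subgroup S -> S a -> S b -> S (a + b).
Proof. by move=> Sg Sa Sb; rewrite -[b]opprK; apply: (proj2 Sg) => //; apply: subgroupN. Qed.

Lemma subgroup_trans (E : zmodType) (S : E -> Prop) b a c :
  subgroup S -> S (a - b) -> S (b - c) -> S (a - c).
Proof. by move=> Sg Sa Sb; rewrite -(subrK b a) -addrA; apply: subgroupD. Qed.

Lemma subgroupC (E : zmodType) (S : E -> Prop) a b :
  subgroup S -> S (a - b) -> S (b - a).
Proof. by move=> Sg Sa; rewrite -opprB; apply: subgroupN. Qed.

Lemma subgroup_sign (E : zmodType) (S : E -> Prop) a k :
  subgroup S -> S a -> S (a *~ (-1) ^+ k).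
Proof.
move=> Sg Sa; rewrite -signr_odd; case: odd => /=; last by rewrite mulr1z.
by rewrite mulrN1z; apply: subgroupN.
Qed.

Section Family.
Variables (E : zmodType) (S : U -> E -> Prop).

(* In both definitions n is the length of the arguments of x; the condition in
   [cocycle_on] is about (n+1)-tuples. *)
Definition cocycle_on R T n (x : seq U -> E) := forall a s,
  All T (a :: s) -> Srt R (a :: s) -> size s = n -> S a (cobd x (a :: s)).

Definition eq_on R T n (x y : seq U -> E) := forall a s,
  All T (a :: s) -> Srt R (a :: s) -> (size s).+1 = n -> S a (x (a :: s) - y (a :: s)).

Definition acyclic R T n := forall x, cocycle_on R T n x ->
  exists y, eq_on R T n x (cobd y).

Hypothesis Sg : forall f, subgroup (S f).
Variable R : U -> U -> Prop.
Hypothesis Rxx : forall f, R f f.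
Hypothesis SR : forall f g e, R f g -> S g e -> S f e.

Lemma eq_on_trans T n x y z : eq_on R T n x y -> eq_on R T n y z -> eq_on R T n x z.
Proof. by move=> H K a s *; apply: (@subgroup_trans _ _ (y (a :: s))) => //;
  [apply: H|apply: K]. Qed.

Lemma cobd_eq_on T n x y a s : (0 < n)%N -> eq_on R T n x y ->
  All T (a :: s) -> Srt R (a :: s) -> size s = n -> S a (cobd x (a :: s) - cobd y (a :: s)).
Proof.
move=> n0 xy Ts Rs ss; rewrite -cobd_zmod; apply: cobd_ind => [||t ft].
- by case: (Sg a).
- by case: (Sg a).
case: t ft => [/drop1_size/= /eqP|b t ft]; first by rewrite eqSS ss; case: n n0 {xy ss}.
apply: SR (drop1_head Rxx Rs ft) _; apply: xy.
- exact: drop1_All ft Ts.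
- exact: drop1_Srt ft Rs.
by have := drop1_size ft => /= -[<-].
Qed.

Lemma eq_on_cobd T n x y : (0 < n)%N -> eq_on R T n x y -> eq_on R T n.+1 (cobd x) (cobd y).
Proof. by move=> n0 xy a s Ts Rs [ss]; apply: cobd_eq_on xy _ _ _. Qed.

Lemma cocycle_cobd T n x y : (0 < n)%N -> eq_on R T n x (cobd y) -> cocycle_on R T n x.
Proof.
move=> n0 xy a s Ts Rs ss; have := cobd_eq_on n0 xy Ts Rs ss.
by rewrite cobdK subr0.
Qed.

(** Coning with [M] as last entry is a contracting homotopy; the first entry, which governs the
    coefficients, stays the same. *)
Lemma acyclic_max T n M : (forall f, T f -> R f M) -> T M -> (0 < n)%N ->
  acyclic R T n.
Proof.
move=> TM TMM n0 x cx; exists (fun t => x (rcons t M) *~ (-1) ^+ n.-1) => a s Ts Rs ss.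
have := cx a (rcons s M); rewrite -rcons_cons cobd_rcons All_rcons Srt_rcons size_rcons ss.
move=> /(_ (conj Ts TMM) (conj Rs (All_imp TM Ts)) erefl).
have -> : size (a :: s) = n by [].
move: n0; case: n ss {cx} => // n ss _ H.
rewrite cobdMz.
have -> : x (a :: s) - cobd (fun t => x (rcons t M)) (a :: s) *~ (-1) ^+ n =
 - ((cobd (fun t => x (rcons t M)) (a :: s) + x (a :: s) *~ (-1) ^+ n.+1) *~ (-1) ^+ n).
  rewrite mulrzDl -mulrzA -exprD addSn addnn -(signr_odd _ _.*2.+1) /= odd_double /= mulrN1z
    opprD opprK.
  by rewrite addrC.
by apply: subgroupN => //; apply: subgroup_sign.
Qed.

End Family.
End QuotientSystems.

(** * Divisible groups *)

Section Extension.
Variables (B D : zmodType).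
Hypothesis Ddiv : forall (d : D) (k : nat), (0 < k)%N -> exists d', d' *+ k = d.

(** The graph of a homomorphism from a subgroup of [B] to [D], so that extending a homomorphism
    means enlarging a set. *)
Definition functional (Gr : set (B * D)) := subgroup Gr /\ forall d, Gr (0, d) -> d = 0.

Lemma subgroupMz (E : zmodType) (S : E -> Prop) a m : subgroup S -> S a -> S (a *~ m).
Proof.
move=> Sg Sa; have Sn (n : nat) : S (a *+ n).
  by elim: n => [|n IH]; [rewrite mulr0n; case: Sg | rewrite mulrS; apply: subgroupD].
case: m => n; first by rewrite -pmulrn; apply: Sn.
by rewrite NegzE mulrNz -pmulrn; apply: subgroupN.
Qed.

Lemma pairMz (a : B) (d : D) m : (a, d) *~ m = (a *~ m, d *~ m).
Proof.
by rewrite [LHS]surjective_pairing (raddfMz (@fst B D)) (raddfMz (@snd B D)).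
Qed.

(** [t] is an admissible value at [b]. If [k] is the least positive integer with [b *+ k] in the
    domain, the value there is divided by [k]; if there is none, 0 serves. *)
Lemma functional_slope (Gr : set (B * D)) b : functional Gr ->
  exists t, forall m d, Gr (b *~ m, d) -> d = t *~ m.
Proof.
move=> [Sg Gr0].
have Gr_fun a d d' : Gr (a, d) -> Gr (a, d') -> d = d'.
  move=> H /(proj2 Sg _ _ H); rewrite -[(a, d) - (a, d')]/(a - a, d - d') subrr.
  by move/Gr0/eqP; rewrite subr_eq0 => /eqP.
pose I (k : nat) := `[< (0 < k)%N /\ exists d, Gr (b *+ k, d) >].
have [exI|nI] := pselect (exists k, I k); last first.
  exists 0 => m d Gm; rewrite mul0rz.
  have [m0|m0] := eqVneq m 0; first by rewrite m0 mulr0z in Gm; apply: Gr0.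
  case: nI; exists `|m|%N; apply/asboolP; split; first by rewrite absz_gt0.
  have [p|p] := lerP 0 m; first by exists d; rewrite pmulrn gez0_abs.
  exists (- d); rewrite pmulrn ltz0_abs// mulrNz.
  exact: (subgroupN Sg Gm).
case: (ex_minnP exI) => k /asboolP[k0 [d0 Gk]] kmin.
have [t td] := Ddiv d0 k0; exists t => m d Gm.
have k0' : k%:Z != 0 by rewrite eqz_nat -lt0n.
have mE := divz_eq m k; set q := (m %/ k)%Z in mE; set r := (m %% k)%Z in mE.
have r0 : r = 0.
  have r_ge : 0 <= r by apply: modz_ge0.
  have r_lt : r < k by apply: ltz_pmod; rewrite ltz_nat.
  apply/eqP/negP => /negP rne.
  have : I `|r|%N.
    apply/asboolP; split; first by rewrite absz_gt0.
    exists (d - d0 *~ q).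
    have := subgroupD Sg Gm (subgroupN Sg (subgroupMz q Sg Gk)).
    rewrite pairMz -[(_, _) - (_, _)]/(_ - _, _ - _).
    rewrite !pmulrn gez0_abs// -mulrzA -mulrzBr; congr (Gr (_ *~ _, _)).
    by rewrite [X in X - _]mE mulrC addrC addKr.
  by move=> /kmin; rewrite -lez_nat gez0_abs// leNgt r_lt.
move: mE; rewrite r0 addr0 => mE; apply: (Gr_fun (b *~ m)) => //.
have := subgroupMz q Sg Gk; rewrite pairMz.
by rewrite mE mulrC -td !pmulrn -!mulrzA.
Qed.

Lemma functional_extend (Gr : set (B * D)) b : functional Gr ->
  exists Gr', [/\ functional Gr', Gr `<=` Gr' & exists d, Gr' (b, d)].
Proof.
move=> GrF; have [t tP] := functional_slope b GrF; case: (GrF) => Sg Gr0.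
exists [set z | exists m, Gr (z.1 - b *~ m, z.2 - t *~ m)]; split.
- split; first split.
  + by exists 0; rewrite !mulr0z !subr0; case: Sg.
  + move=> [a d] [a' d'] [m Gm] [m' Gm']; exists (m - m').
    have := proj2 Sg _ _ Gm Gm'; rewrite -[(_, _) - (_, _)]/(_ - _, _ - _) /=.
    by rewrite !mulrzBr subrACA [X in (_, X)]subrACA.
  + move=> d [m]; rewrite /= sub0r -mulrNz => /tP.
    by rewrite mulrNz => /(congr1 (+%R^~ (t *~ m))); rewrite subrK addNr.
- by move=> [a d] Ga; exists 0; rewrite !mulr0z !subr0.
by exists t; exists 1; rewrite !mulr1z !subrr; case: Sg.
Qed.

(** Divisible groups are injective: Zorn's lemma gives a maximal partial homomorphism, and it is
    total because it extends to any further element. *)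
Lemma functional_total (Gr : set (B * D)) : functional Gr ->
  exists h : B -> D, zmod_morphism h /\ forall a d, Gr (a, d) -> h a = d.
Proof.
move=> GrF.
(* [Gr] is joined to every candidate, so that the empty chain has a bound too. *)
have [|A [PA maxA]] := @Zorn_bigcup _ (fun X => functional (X `|` Gr)).
  move=> F FP Ftot.
  have dir z w : (\bigcup_(X in F) X `|` Gr) z -> (\bigcup_(X in F) X `|` Gr) w ->
      exists X, [/\ functional (X `|` Gr), (X `|` Gr) z, (X `|` Gr) w &
         X `<=` \bigcup_(X in F) X].
    have sup X : F X -> X `<=` \bigcup_(X in F) X by move=> FX u Xu; exists X.
    move=> [[X FX Xz]|Gz] [[Y FY Yw]|Gw].
    - have [XY|YX] := Ftot X Y FX FY.
        by exists Y; split; [exact: FP|left; exact: XY|left|exact: sup].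
      by exists X; split; [exact: FP|left|left; exact: YX|exact: sup].
    - by exists X; split; [exact: FP|left|right|exact: sup].
    - by exists Y; split; [exact: FP|right|left|exact: sup].
    - by exists set0; split; [rewrite set0U|right|right|].
  split; first split.
  - by right; case: GrF => -[].
  - move=> z w Hz Hw; have [X [[[_ XB] _] Xz Xw XU]] := dir _ _ Hz Hw.
    by have [/XU|] := XB _ _ Xz Xw; [left|right].
  - by move=> d Hd; have [X [[_ X0] Xz _ _]] := dir _ _ Hd Hd; apply: X0.
set Gm := A `|` Gr in PA.
have tot b : exists d, Gm (b, d).
  have [Gr' [FG' sub [d Gd]]] := functional_extend b PA.
  apply: contrapT => nd; apply: (maxA Gr').
    split; first by move=> z Az; apply: sub; left.
    by move=> E; apply: nd; exists d; left; apply: E.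
  rewrite (_ : Gr' `|` Gr = Gr')//; apply/seteqP; split; last by left.
  by move=> z [//|Gz]; apply: sub; right.
have /choice[h hP] := tot; case: PA => Sg Gm0.
have hE a d : Gm (a, d) -> h a = d.
  move=> H; have := proj2 Sg _ _ (hP a) H; rewrite -[(_, _) - (_, _)]/(_ - _, _ - _) subrr.
  by move=> /Gm0 /eqP; rewrite subr_eq0 => /eqP.
exists h; split; last by move=> a d Gad; apply: hE; right.
by move=> a c; apply: hE; exact: (proj2 Sg _ _ (hP a) (hP c)).
Qed.
End Extension.

(** * The group Q/Z and separation of points *)

Section QZ.

Definition int_rat : {pred rat} := fun q => q \is a Num.int.

Lemma int_rat_zmod_closed : zmod_closed int_rat.
Proof. by split=> [|x y]; [exact: rpred0 | exact: rpredB]. Qed.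

HB.instance Definition _ := GRing.isZmodClosed.Build rat int_rat int_rat_zmod_closed.

Definition QZ : zmodType := Quotient.quot int_rat.

Definition toQZ (q : rat) : QZ := \pi_(QZ)%qT q.

Lemma toQZ_zmod : zmod_morphism toQZ.
Proof. by move=> x y; rewrite /toQZ raddfB. Qed.

HB.instance Definition _ := GRing.isZmodMorphism.Build rat QZ toQZ toQZ_zmod.

Lemma toQZ_surj d : toQZ (repr d) = d.
Proof. exact: reprK. Qed.

Lemma toQZ_eq0 q : (toQZ q == 0) = (q \is a Num.int).
Proof. by rewrite -(raddf0 toQZ) /toQZ -Quotient.idealrBE subr0. Qed.

Lemma QZ_div (d : QZ) (k : nat) : (0 < k)%N -> exists d', d' *+ k = d.
Proof.
move=> k0; exists (toQZ (repr d / k%:R)); rewrite -raddfMn /= -(mulr_natr (_ / _)) divfK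
  ?toQZ_surj//.
by rewrite pnatr_eq0 -lt0n.
Qed.

Lemma toQZ_inv_neq0 k : (1 < k)%N -> toQZ (k%:R^-1) != 0.
Proof.
move=> k1; rewrite toQZ_eq0; apply/negP => /intrP[i iE].
have : 0 < (k%:R : rat)^-1 by rewrite invr_gt0 ltr0n ltnW.
have : (k%:R : rat)^-1 < 1 by rewrite invf_lt1 ?ltr1n ?ltr0n// ltnW.
by rewrite iE ltr0z ltrz1; case: i {iE} => [[]|].
Qed.

(** Send [a] to the class of 1/k if it has finite order k and to that of 1/2 if its order is
    infinite; injectivity of Q/Z extends this map from the multiples of [a]. *)
Lemma QZ_separates (A : zmodType) (a : A) : a != 0 ->
  exists h : A -> QZ, zmod_morphism h /\ h a != 0.
Proof.
move=> a0.
have [t t0 tP] : exists2 t : QZ, t != 0 & forall m, a *~ m = 0 -> t *~ m = 0.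
  pose I (k : nat) := (0 < k)%N && (a *+ k == 0).
  have [exI|nI] := pselect (exists k, I k); last first.
    exists (toQZ (2%:R^-1)) => [|m am]; first exact: toQZ_inv_neq0.
    have [->|m0] := eqVneq m 0; first by rewrite mulr0z.
    case: nI; exists `|m|%N; rewrite /I absz_gt0 m0 /=.
    have [p|p] := lerP 0 m; first by rewrite pmulrn gez0_abs// am.
    by rewrite pmulrn ltz0_abs// mulrNz am oppr0.
  case: (ex_minnP exI) => k /andP[k0 /eqP ak] kmin.
  have k1 : (1 < k)%N.
    by rewrite ltn_neqAle k0 andbT; apply: contra a0 => /eqP k1; rewrite -ak -k1 mulr1n.
  exists (toQZ (k%:R^-1)) => [|m am]; first exact: toQZ_inv_neq0.
  have := divz_eq m k; set q := (m %/ k)%Z; set r := (m %% k)%Z => mE.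
  have r0 : r = 0.
    have r_ge : 0 <= r by apply: modz_ge0; rewrite eqz_nat -lt0n.
    have r_lt : r < k by apply: ltz_pmod; rewrite ltz_nat.
    apply/eqP/negP => /negP rne.
    have : I `|r|%N.
      rewrite /I absz_gt0 rne /= pmulrn gez0_abs//; move: am;
        rewrite mE mulrzDr mulrC mulrzA -pmulrn ak.
      by rewrite mul0rz add0r => ->.
    by move=> /kmin; rewrite -lez_nat gez0_abs// leNgt r_lt.
  rewrite mE r0 addr0 mulrC mulrzA -pmulrn -raddfMn /= -(mulr_natr (_^-1)) mulVf ?pnatr_eq0
    -?lt0n//.
  by rewrite (_ : toQZ 1 = 0) ?mul0rz//; apply/eqP; rewrite toQZ_eq0.
have [|h [ha hE]] := @functional_total A QZ QZ_div [set z | exists m, z = (a *~ m, t *~ m)].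
  split; first split.
  - by exists 0; rewrite !mulr0z.
  - move=> _ _ [m ->] [m' ->]; exists (m - m').
    by rewrite -[(_, _) - (_, _)]/(_ - _, _ - _) !mulrzBr.
  by move=> d [m [/esym /tP <- ->]].
exists h; split=> //; rewrite (hE a t)//; by exists 1; rewrite !mulr1z.
Qed.

End QZ.

(** * Filtrations *)

Section Filtration.
Variables (U : Type) (W : woset) (F : W -> U -> Prop).
Hypothesis W0 : inhabited W.
Hypothesis Fmono : forall a b f, wle a b -> F a f -> F b f.

Definition Flt a f := exists2 b, wlt b a & F b f.
Definition Fall f := exists b, F b f.

Lemma FltW a f : Flt a f -> F a f.
Proof. by move=> [b /wltW ba]; apply: Fmono. Qed.

Lemma F_Flt a b f : wlt a b -> F a f -> Flt b f.
Proof. by move=> ab Fa; exists a. Qed.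

Lemma All_Flt a s : s <> [::] -> All (Flt a) s -> exists2 b, wlt b a & All (F b) s.
Proof.
elim: s => // f [|g s] IH _ [[b ba Fb] Fs]; first by exists b.
have [//|//|c ca Fc] := IH.
have /orP[bc|cb] := wle_total b c.
  by exists c => //; split=> //; apply: Fmono bc _.
by exists b => //; split=> //; apply: All_imp Fc => h; apply: Fmono.
Qed.

Lemma All_Fall s : All Fall s -> exists b, All (F b) s.
Proof.
have [w0] := W0; elim: s => [_|f s IH [[b Fb] /IH[c Fc]]]; first by exists w0.
have /orP[bc|cb] := wle_total b c.
  by exists c => //; split=> //; apply: Fmono bc _.
by exists b => //; split=> //; apply: All_imp Fc => h; apply: Fmono.
Qed.

Definition rank_of (rk : seq U -> W) := forall s, All Fall s ->
  All (F (rk s)) s /\ forall a, All (F a) s -> wle (rk s) a.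

Lemma rank_ex : exists rk, rank_of rk.
Proof.
suff /choice[rk rkP] : forall s, exists b, All Fall s ->
    All (F b) s /\ forall a, All (F a) s -> wle b a.
  by exists rk => s; exact: rkP.
move=> s; have [w0] := W0.
have [Fs|nF] := pselect (All Fall s); last by exists w0.
by have [b Fb bmin] := wle_min (All_Fall Fs); exists b.
Qed.

Lemma F_Fall a s : All (F a) s -> All Fall s.
Proof. by apply: All_imp => f Ff; exists a. Qed.

Lemma rank_le rk a s : rank_of rk -> All (F a) s -> wle (rk s) a.
Proof. by move=> H Fs; apply: (proj2 (H s (F_Fall Fs))). Qed.

Lemma rank_lt rk a s : rank_of rk -> s <> [::] -> All (Flt a) s -> wlt (rk s) a.
Proof.
by move=> H s0 /(All_Flt s0)[b ba /(rank_le H) le]; apply: wle_lt_trans ba.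
Qed.

Section Step.
Variables (E : zmodType) (S : U -> E -> Prop) (R : U -> U -> Prop).
Hypothesis Sg : forall f, subgroup (S f).
Hypothesis Rxx : forall f, R f f.
Hypothesis SR : forall f g e, R f g -> S g e -> S f e.

(** A primitive is built stage by stage. On the earlier stages, a primitive [y1] on [F a] and the
    part [y0] already built differ by an [n]-cocycle; a primitive [w] of the difference corrects
    [y1] so that it extends [y0]. *)
Lemma acyclic_filtration n : (0 < n)%N ->
  (forall a, acyclic S R (Flt a) n) -> (forall a, acyclic S R (F a) n.+1) ->
  acyclic S R Fall n.+1.
Proof.
move=> n0 aclt acle x cx; have [rk rkP] := rank_ex.
pose good a (y0 y : seq U -> E) := eq_on S R (F a) n.+1 x (cobd y) /\
  forall s, All (Flt a) s -> size s = n -> y s = y0 s.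
have /choice[P PP] : forall ay : W * (seq U -> E), exists y,
    (exists y, good ay.1 ay.2 y) -> good ay.1 ay.2 y.
  move=> [a y0] /=; have [[y gy]|ng] := pselect (exists y, good a y0 y).
    by exists y => _.
  by exists y0 => /ng.
have [y yP] := recursive_ex rk 0 (fun a y0 => P (a, y0)).
exists y.
suff H a : eq_on S R (F a) n.+1 x (cobd y).
  by move=> f s Fs Rs ss; have [b Fb] := All_Fall Fs; apply: (H b).
elim/wlt_ind: a => a IH.
pose y0 := trunc rk 0 a y.
have ne s k : size s = k -> (0 < k)%N -> s <> [::] :> seq U by move=> <- + E0; rewrite E0.
have xy0 : eq_on S R (Flt a) n.+1 x (cobd y0).
  move=> f s Fs Rs ss; have [//|b ba Fb] := All_Flt _ Fs.
  rewrite (_ : cobd y0 (f :: s) = cobd y (f :: s)); first exact: (IH b).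
  apply: eq_cobd => t ft; rewrite /y0 /trunc ifT//.
  by apply: wle_lt_trans ba; apply: (rank_le rkP); apply: drop1_All ft Fb.
have [y1 xy1] : exists y1, eq_on S R (F a) n.+1 x (cobd y1).
  by apply: acle => f s Fs; apply: cx; apply: F_Fall Fs.
have [w wP] : exists w, eq_on S R (Flt a) n (fun s => y1 s - y0 s) (cobd w).
  apply: aclt => f s Fs Rs ss; rewrite cobd_zmod.
  apply: (subgroup_trans (b := x (f :: s))) => //.
    by apply: subgroupC => //; apply: xy1 => //; [apply: All_imp Fs => g; exact: FltW|rewrite ss].
  by apply: xy0; rewrite ?ss.
(* Agreement with [y0] on earlier tuples must be exact; imposing it changes [y1 - cobd w] only
   modulo [S]. *)
pose y2 s := if `[< All (Flt a) s >] then y0 s else y1 s - cobd w s.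
have good2 : good a y0 y2.
  split; last by move=> s Fs _; rewrite /y2 asboolT.
  apply: (eq_on_trans Sg xy1).
  have -> : cobd y1 = cobd (fun s => y1 s - cobd w s).
    by apply/funext => s; rewrite cobd_zmod cobdK subr0.
  apply: (eq_on_cobd Sg Rxx SR n0) => f s Fs Rs ss; rewrite /y2; case: asboolP => Fs'; last first.
    by rewrite subrr; case: (Sg f).
  by have := wP f s Fs' Rs ss; rewrite addrAC.
have [] := PP (a, y0) (ex_intro _ _ good2) => /= xP yPy0.
move=> f s Fs Rs ss; rewrite (_ : cobd y _ = cobd (P (a, y0)) (f :: s)); first exact: xP.
apply: eq_cobd => t ft.
have Ft := drop1_All ft Fs.
have st : size t = n by have := drop1_size ft; rewrite /= ss => -[->].
have /wle_eqVlt[rt|rt] := rank_le rkP Ft; first by rewrite yP rt.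
have Ft' : All (Flt a) t.
  by apply: All_imp (proj1 (rkP _ (F_Fall Ft))) => g; apply: F_Flt.
by rewrite yPy0// /y0 /trunc rt.
Qed.

End Step.
End Filtration.

(** * Ideals of functions *)

Local Notation fn := (nat -> nat).

Lemma cofiniteP (A : set nat) : cofinite_set A <-> exists N, forall i, (N <= i)%N -> A i.
Proof.
split=> [|[N H]].
  move=> /finite_seqP[X XE]; exists (\max_(i <- X) i).+1 => i iX.
  apply: contrapT => nAi; have : (~` A) i by [].
  rewrite XE /= => iX'; move: iX; rewrite ltnNge => /negP; apply.
  exact: (@leq_bigmax_seq _ X xpredT id i iX' isT).
apply: (@sub_finite_set _ _ `I_N) => [i /= nA|]; last exact: finite_II.
by rewrite ltnNge; apply/negP => /H.
Qed.

Lemma le_starP (f g : fn) : le_star f g <-> exists N, forall i, (N <= i)%N -> (f i <= g i)%N.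
Proof. exact: cofiniteP. Qed.

Lemma le_star_trans (g f h : fn) : le_star f g -> le_star g h -> le_star f h.
Proof.
move=> /le_starP[N fg] /le_starP[M gh]; apply/le_starP; exists (maxn N M) => i.
by rewrite geq_max => /andP[Ni Mi]; apply: leq_trans (fg i Ni) (gh i Mi).
Qed.

Definition fmax (f g : fn) : fn := fun i => maxn (f i) (g i).

Lemma fmaxl f g : le_star f (fmax f g).
Proof. by apply/le_starP; exists 0 => i _; apply: leq_maxl. Qed.

Lemma fmaxr f g : le_star g (fmax f g).
Proof. by apply/le_starP; exists 0 => i _; apply: leq_maxr. Qed.

Lemma fmax_lub f g h : le_star f h -> le_star g h -> le_star (fmax f g) h.
Proof.
move=> /le_starP[N fh] /le_starP[M gh]; apply/le_starP; exists (maxn N M) => i.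
by rewrite geq_max => /andP[Ni Mi]; rewrite geq_max fh ?gh.
Qed.

Inductive ideal (A : fn -> Prop) : fn -> Prop :=
| ideal_gen f : A f -> ideal A f
| ideal_join f g : ideal A f -> ideal A g -> ideal A (fmax f g)
| ideal_down f g : le_star f g -> ideal A g -> ideal A f.

Lemma ideal_ub A M f : (forall f, A f -> le_star f M) -> ideal A f -> le_star f M.
Proof.
move=> AM; elim=> [g /AM//|g h _ ? _ ?|g h gh _]; first exact: fmax_lub.
exact: le_star_trans.
Qed.

Lemma ideal_sub (A B : fn -> Prop) f : (forall f, A f -> ideal B f) -> ideal A f -> ideal B f.
Proof.
move=> AB; elim=> [g /AB//|g h _ ? _ ?|g h gh _]; first exact: ideal_join.
exact: ideal_down.
Qed.

Lemma ideal_empty (A : fn -> Prop) f : (forall f, ~ A f) -> ~ ideal A f.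
Proof. by move=> A0; elim=> // g /A0. Qed.

Section IdealFiltration.
Variables (W : woset) (gen : W -> fn -> Prop).

Definition ideal_le a := ideal (fun f => exists2 b, wle b a & gen b f).

Lemma ideal_le_mono a b f : wle a b -> ideal_le a f -> ideal_le b f.
Proof.
move=> ab; apply: ideal_sub => g [c ca gg]; apply: ideal_gen; exists c => //.
exact: wle_trans ab.
Qed.

Lemma ideal_Flt a : Flt ideal_le a = ideal (fun f => exists2 b, wlt b a & gen b f).
Proof.
apply/funext => f; apply/propext; split.
  move=> [b ba]; apply: ideal_sub => g [c cb gg]; apply: ideal_gen; exists c => //.
  exact: wle_lt_trans ba.
elim=> [g [b ba gg]|g h _ [b ba gb] _ [c ca hc]|g h gh _ [b ba hb]].
- by exists b => //; apply: ideal_gen; exists b => //; apply: wle_refl.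
- have /orP[bc|cb] := wle_total b c.
    by exists c => //; apply: ideal_join => //; apply: ideal_le_mono gb.
  by exists b => //; apply: ideal_join => //; apply: ideal_le_mono hc.
by exists b => //; apply: ideal_down hb.
Qed.

Lemma ideal_Fall : Fall ideal_le = ideal (fun f => exists b, gen b f).
Proof.
apply/funext => f; apply/propext; split.
  by move=> [b]; apply: ideal_sub => g [c cb gg]; apply: ideal_gen; exists c.
elim=> [g [b gg]|g h _ [b gb] _ [c hc]|g h gh _ [b hb]].
- by exists b; apply: ideal_gen; exists b => //; apply: wle_refl.
- have /orP[bc|cb] := wle_total b c.
    by exists c; apply: ideal_join => //; apply: ideal_le_mono gb.
  by exists b; apply: ideal_join => //; apply: ideal_le_mono hc.
by exists b; apply: ideal_down hb.
Qed.

End IdealFiltration.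

(** * Functions modulo finite support and vanishing in high degree *)

Section FinSupp.
Variable G : zmodType.

(* Finiteness of the support on I_f, as each column of I_f is finite. *)
Definition Sfin (f : fn) (e : nat * nat -> G) : Prop :=
  exists N, forall i j, (N <= i)%N -> (j < f i)%N -> e (i, j) = 0.

Lemma Sfin_subgroup f : subgroup (Sfin f).
Proof.
split=> [|a b [N aN] [M bM]]; first by exists 0.
exists (maxn N M) => i j; rewrite geq_max => /andP[Ni Mi] ji.
by rewrite [LHS]/GRing.add /= [X in _ + X]/GRing.opp /= aN// bM// subr0.
Qed.

Lemma Sfin_le f g e : le_star f g -> Sfin g e -> Sfin f e.
Proof.
move=> /le_starP[M fg] [N eN]; exists (maxn N M) => i j.
rewrite geq_max => /andP[Ni Mi] ji; apply: eN => //; exact: leq_trans (fg i Mi).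
Qed.

Lemma Sfin_sub f (d e : nat * nat -> G) : Sfin f (d - e) <->
  exists N, forall i j, (N <= i)%N -> (j < f i)%N -> d (i, j) = e (i, j).
Proof.
split=> -[N H]; exists N => i j Ni ji; last first.
  by rewrite [LHS]/GRing.add /= [X in _ + X]/GRing.opp /= H// subrr.
by apply/eqP; rewrite -subr_eq0; apply/eqP; exact: (H i j).
Qed.

Lemma finite_rank_max (r : fn -> nat) N (B : fn -> Prop) :
  (forall f g, B f -> B g -> r f = r g -> f = g) -> (forall f, B f -> (r f < N)%N) ->
  (exists f, B f) -> exists2 M, ideal B M & forall f, ideal B f -> le_star f M.
Proof.
suff : (forall f g, B f -> B g -> r f = r g -> f = g) -> (forall f, B f -> (r f < N)%N) ->
  (exists f, B f) -> exists2 M, ideal B M & forall f, B f -> le_star f M.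
  by move=> H B1 B2 B3; have [//|//|//|M BM MM] := H; exists M => // f; apply: ideal_ub.
elim: N B => [|N IH] B Binj BN [f0 Bf0]; first by have := BN _ Bf0.
have [[f1 [Bf1 f1N]]|nB] := pselect (exists f, B f /\ r f = N); last first.
  apply: IH => //; last by exists f0.
  by move=> f Bf; have := BN f Bf; rewrite ltnS leq_eqVlt => /orP[/eqP E|//]; case: nB; exists f.
have [[f2 [Bf2 f2N]]|nB] := pselect (exists f, B f /\ (r f < N)%N); last first.
  exists f1; first exact: ideal_gen.
  move=> f Bf; have := BN f Bf; rewrite ltnS leq_eqVlt => /orP[/eqP E|lt].
    by rewrite (Binj f f1)// ?E ?f1N//; apply: le_star_refl.
  by case: nB; exists f.
have [||M BM MM] := IH (fun f => B f /\ (r f < N)%N) _ (fun f H => proj2 H).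
- by move=> f g [Bf _] [Bg _]; apply: Binj.
- by exists f2.
exists (fmax M f1).
  apply: ideal_join; last exact: ideal_gen.
  by apply: ideal_sub BM => f [Bf _]; apply: ideal_gen.
move=> f Bf; have := BN f Bf; rewrite ltnS leq_eqVlt => /orP[/eqP E|lt].
  by rewrite (Binj f f1)// ?E ?f1N//; apply: fmaxr.
by apply: le_star_trans (fmaxl _ _); apply: MM.
Qed.

Lemma acyclic_finite (r : fn -> nat) N (B : fn -> Prop) n :
  (forall f g, B f -> B g -> r f = r g -> f = g) -> (forall f, B f -> (r f < N)%N) ->
  acyclic Sfin le_star (ideal B) n.+1.
Proof.
move=> Binj BN; have [exB|nB] := pselect (exists f, B f).
  have [M BM MM] := finite_rank_max Binj BN exB.
  by apply: (acyclic_max Sfin_subgroup (M := M)).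
by move=> x _; exists x => f s [/ideal_empty H]; case: H => g Bg; case: nB; exists g.
Qed.

(** Partial maxima of an enumeration of [A]; they increase at every argument, not only up to finite
    errors. *)
Lemma countable_cofinal (A : fn -> Prop) : into nat A -> (exists f, A f) ->
  exists p : nat -> fn, [/\ forall k, ideal A (p k),
    forall k l i, (k <= l)%N -> (p k i <= p l i)%N & forall f, ideal A f -> exists k, le_star f
      (p k)].
Proof.
move=> [r rinj] [f0 Af0].
have /choice[a aP] : forall k, exists f, A f /\ forall g, A g -> r g = k -> f = g.
  move=> k; have [[f [Af fk]]|nA] := pselect (exists f, A f /\ r f = k).
    by exists f; split=> // g Ag gk; apply: rinj => //; rewrite fk gk.
  by exists f0; split=> // g Ag gk; case: nA; exists g.
pose fix p k := if k is k'.+1 then fmax (p k') (a k) else a 0%N.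
have pmono k l i : (k <= l)%N -> (p k i <= p l i)%N.
  move=> /subnK <-; elim: (l - k)%N => // d IH; apply: leq_trans IH _; exact: leq_maxl.
have ap k i : (a k i <= p k i)%N by case: k => //= k; apply: leq_maxr.
exists p; split=> // [k|f].
  elim: k => [|k IH]; first by apply: ideal_gen; case: (aP 0%N).
  by apply: ideal_join IH _; apply: ideal_gen; case: (aP k.+1).
elim=> [g Ag|g h _ [k gk] _ [l hl]|g h gh _ [k hk]].
- exists (r g); have [_ /(_ g Ag erefl) E] := aP (r g).
  rewrite -[X in le_star X _]E; by apply/le_starP; exists 0%N => i _; apply: ap.
- exists (maxn k l); apply: fmax_lub.
    by apply: le_star_trans gk _; apply/le_starP; exists 0%N => i _; apply: pmono; apply: leq_maxl.
  by apply: le_star_trans hl _; apply/le_starP; exists 0%N => i _; apply: pmono; apply: leq_maxr.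
by exists k; apply: le_star_trans hk.
Qed.

(** At a point, [psi] takes the value of the member of the family at the first [p k] whose region
    contains the point. Below [p l] only indices up to [l] occur, so finitely many finite errors
    arise. *)
Lemma acyclic_countable (A : fn -> Prop) : into nat A ->
  acyclic Sfin le_star (ideal A) 1.
Proof.
move=> Anat; have [exA|nA] := pselect (exists f, A f); last first.
  by move=> x _; exists x => f s [/ideal_empty H]; case: H => g Ag; case: nA; exists g.
have [p [pA pmono pcof]] := countable_cofinal Anat exA.
move=> x cx.
have xp k l : (k <= l)%N -> Sfin (p k) (x [:: p l] - x [:: p k]).
  move=> kl; have := cx (p k) [:: p l]; rewrite /= subr0; apply=> //.
  by do !split=> //; apply/le_starP; exists 0%N => i _; apply: pmono.
pose Q (q : nat * nat) k := (q.2 < p k q.1)%N.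
pose psi q := match pselect (exists k, Q q k) with
  | left h => x [:: p (ex_minn h)] q | right _ => 0 end.
exists (fun=> psi) => f s [If _] _ [/size0nil ->] /=; rewrite subr0.
have [l fl] := pcof _ If.
apply: (subgroup_trans (b := x [:: p l])) (Sfin_subgroup f) _ _.
  apply: subgroupC (Sfin_subgroup f) _; have := cx f [:: p l]; rewrite /= subr0; apply=> //.
apply: Sfin_le fl _; apply/Sfin_sub.
have /choice[N NP] : forall k, exists N, (k <= l)%N -> forall i j, (N <= i)%N -> (j < p k i)%N ->
    x [:: p l] (i, j) = x [:: p k] (i, j).
  move=> k; have [kl|] := boolP (k <= l)%N; last by exists 0%N.
  by have /Sfin_sub[N NP] := xp _ _ kl; exists N.
exists (\max_(k < l.+1) N k) => i j Ni ji; rewrite /psi; case: pselect => [h|]; last by case;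
  exists l.
case: ex_minnP => k Qk /(_ l ji) kl; apply: NP => //.
by apply: leq_trans Ni; apply: (leq_bigmax (Ordinal (kl : k < l.+1)%N)).
Qed.

(** Induction on [k]: filter along [omega k] into ideals with fewer generators, each cardinal
    costing one degree. For [k = 0] in higher degrees the stages are finitely generated and so, if
    nonempty, have a maximum. *)
Lemma acyclic_ideal k m (A : fn -> Prop) : (k <= m)%N -> into (omega k) A ->
  acyclic Sfin le_star (ideal A) m.+1.
Proof.
elim: k m A => [|k IH] [|m] A // km Ak.
- exact: acyclic_countable.
- have [r rinj] := Ak; pose gen (w : omega 0) f := A f /\ r f = w.
  have -> : ideal A = Fall (ideal_le gen).
    rewrite ideal_Fall; congr ideal; apply/funext => f; apply/propext.
    by split=> [Af|[b []//]]; exists (r f).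
  apply: (acyclic_filtration (omega_inh _) (@ideal_le_mono _ gen) Sfin_subgroup
    le_star_refl Sfin_le) => // a.
  + rewrite ideal_Flt; apply: (@acyclic_finite r a).
      by move=> f g [_ _ [Af _]] [_ _ [Ag _]]; apply: rinj.
    by move=> f [b ba [_ ->]]; move: ba; rewrite wltNge -ltnNge.
  + apply: (@acyclic_finite r a.+1).
      by move=> f g [_ _ [Af _]] [_ _ [Ag _]]; apply: rinj.
    by move=> f [b ba [_ ->]].
have [r rinj] := Ak; pose gen (w : omega k.+1) f := A f /\ r f = w.
have -> : ideal A = Fall (ideal_le gen).
  rewrite ideal_Fall; congr ideal; apply/funext => f; apply/propext.
  by split=> [Af|[b []//]]; exists (r f).
have seg (B : omega k.+1 -> Prop) : into (omega k) B ->
    into (omega k) (fun f => exists2 b, B b & gen b f).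
  move=> [h hi]; exists (h \o r) => f g [b Bb [Af fb]] [c Bc [Ag gc]] /= E.
  by apply: rinj => //; apply: hi; rewrite ?fb ?gc// -?fb -?gc.
apply: (acyclic_filtration (omega_inh _) (@ideal_le_mono _ gen) Sfin_subgroup
  le_star_refl Sfin_le) => // a.
- by rewrite ideal_Flt; apply: IH => //; apply: seg; apply: seg_into (infinite_omega k) _.
- by apply: IH; [exact: ltnW | apply: seg; apply: segle_into (infinite_omega k) _].
Qed.

End FinSupp.

(** * The construction *)

(** Choice with a default, so that twists and primitives can be defined before their existence is
    known. *)
Definition some_such T (t0 : T) (P : T -> Prop) : T :=
  match pselect (exists t, P t) with left h => projT1 (cid h) | right _ => t0 end.

Lemma some_suchP T (t0 : T) (P : T -> Prop) : (exists t, P t) -> P (some_such t0 P).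
Proof. by rewrite /some_such; case: pselect => // h _; apply: (projT2 (cid h)). Qed.

Lemma into_image T U V (B : T -> Prop) (c : T -> U) :
  inhabited V -> into V B -> into V (fun u => exists2 t, B t & u = c t).
Proof.
move=> [v0] [h hi]; have [[t0 Bt0]|nB] := pselect (exists t, B t); last first.
  by exists (fun=> v0) => x y [t Bt _]; case: nB; exists t.
exists (fun u => h (some_such t0 (fun t => B t /\ u = c t))) => x y [t Bt xE] [t' Bt' yE].
have [] := @some_suchP _ t0 (fun t => B t /\ x = c t) (ex_intro _ t (conj Bt xE)).
have [] := @some_suchP _ t0 (fun t => B t /\ y = c t) (ex_intro _ t' (conj Bt' yE)).
by move=> By E1 Bx E2 /hi E; rewrite E1 E2 E.
Qed.

Section Twist.
Variables (k : nat) (G D : zmodType) (pi : {additive G -> D}).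
Let V := omega k.
Let W := omega k.+1.
Notation EG := (nat * nat -> G).
Notation ED := (nat * nat -> D).

Definition push (e : EG) : ED := fun p => pi (e p).

Lemma push_zmod : zmod_morphism push.
Proof. by move=> d e; apply/funext => p; exact: (raddfB pi). Qed.

HB.instance Definition _ := GRing.isZmodMorphism.Build EG ED push push_zmod.

Lemma push_Sfin f e : Sfin f e -> Sfin f (push e).
Proof. by move=> [N eN]; exists N => i j Ni ji; rewrite /push eN// raddf0. Qed.

Variables (A : fn -> Prop) (r : fn -> W) (c : W -> fn).
Hypothesis rinj : forall f g, A f -> A g -> r f = r g -> f = g.
Hypothesis cmono : forall i j, wle i j -> le_star (c i) (c j).
Hypothesis cA : forall i, ideal A (c i).
Hypothesis cunb : forall p, ideal A p -> exists i, ~ le_star (c i) p.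

(** The chain is put among the generators with its own indexing, so that [c a] is present from stage
    [a] on. *)
Definition gens (w : W) (f : fn) := f = c w \/ A f /\ r f = w.
Definition below (a : W) : fn -> Prop := fun f => exists2 b, wlt b a & gens b f.
Notation F := (ideal_le gens).
Notation Fl := (Flt (ideal_le gens)).
Notation coc := (cocycle_on (@Sfin G) le_star).
Notation equ := (eq_on (@Sfin G) le_star).

Lemma below_into a : into V (below a).
Proof.
have sa := seg_into (infinite_omega k) a.
apply: into_sub (into_pair (infinite_omega k) (into_image c (omega_inh k) sa) (B := fun f => A f
  /\ wlt (r f) a) _).
  by move=> f [b ba [->|[Af fb]]]; [left; exists b | right; rewrite fb].
have [h hi] := sa; exists (h \o r) => f g [Af fa] [Ag ga] /= E.
by apply: rinj => //; apply: hi.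
Qed.

Lemma Fl_ideal a : Fl a = ideal (below a).
Proof. exact: ideal_Flt. Qed.

Lemma Fl_acyclic a : acyclic (@Sfin G) le_star (Fl a) k.+1.
Proof. by rewrite Fl_ideal; apply: (@acyclic_ideal G k k _ (leqnn k)); exact: below_into. Qed.

Lemma Fall_ideal : Fall F = ideal A.
Proof.
rewrite ideal_Fall; apply/funext => f; apply/propext; split.
  by apply: ideal_sub => g [b [->|[Ag _]]]; [exact: cA | exact: ideal_gen].
by apply: ideal_sub => g Ag; apply: ideal_gen; exists (r g); right.
Qed.

Lemma c_F a : F a (c a).
Proof. by apply: ideal_gen; exists a; [exact: wle_refl | left]. Qed.

Lemma c_Fl a b : wlt a b -> Fl b (c a).
Proof. by move=> ab; exists a => //; exact: c_F. Qed.

(* Triviality on the chain below a; for k = 0 this says u [::] is finite on I_(c a). *)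
Definition triv_below (a : W) (u : seq W -> ED) := exists v : seq W -> ED,
  forall s, All (fun b => wlt b a) s -> Srt (fun i j : W => wle i j) s -> size s = k ->
    Sfin (c (head a s)) (u s - cobd v s).

Lemma triv_belowB a u u' : triv_below a u -> triv_below a u' ->
  triv_below a (fun s => u s - u' s).
Proof.
move=> [v uv] [v' uv']; exists (fun s => v s - v' s) => s sa ss sk.
rewrite cobd_zmod; have := proj2 (Sfin_subgroup _ _) _ _ (uv s sa ss sk) (uv' s sa ss sk).
by rewrite subrACA.
Qed.

Lemma eq_triv_below a u u' : (forall s, All (fun b => wlt b a) s -> u s = u' s) ->
  triv_below a u -> triv_below a u'.
Proof. by move=> uu [v uv]; exists v => s sa *; rewrite -uu//; apply: uv. Qed.

(** The candidates for the cocycle added when the bit at [a] is 1. For [k = 0], [z [::]] has finite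
    support on I_f for each earlier f, but its image under [pi] has infinite support on I_(c a). *)
Definition twistor a (z : seq fn -> EG) :=
  coc (Fl a) k z /\ ~ triv_below a (fun s => push (z (map c s))).

Definition twist a : seq fn -> EG := some_such (fun=> 0) (twistor a).

Lemma twist_cocycle a : coc (Fl a) k (twist a).
Proof.
have [h|nh] := pselect (exists z, twistor a z); first by have [] := some_suchP (fun=> 0) h.
rewrite /twist /some_such; case: pselect => // _ f s _ _ _; rewrite cobd0.
by case: (Sfin_subgroup G f).
Qed.

Definition primitive a (x : seq fn -> EG) : seq fn -> EG :=
  some_such (fun=> 0) (fun y => equ (Fl a) k.+1 x (cobd y)).

Definition twisted a x (e : bool) s : EG :=
  if `[< All (Fl a) s >] then primitive a x s + (if e then twist a s else 0) else 0.

Definition stage (b : W -> bool) a (x : seq fn -> EG) : seq fn -> EG := cobd (twisted a x (b a)).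

(** * The branch determined by a sequence of bits *)

Section Ranked.
Variable rk : seq fn -> W.
Hypothesis rkP : rank_of F rk.
Notation tr := (trunc rk (0 : EG)).

Section Branch.
Variables (b : W -> bool) (x : seq fn -> EG).
Hypothesis xP : recursive rk 0 (stage b) x.

Lemma tr_eq a s : s <> [::] -> All (Fl a) s -> tr a x s = x s.
Proof. by move=> s0 Fs; rewrite /trunc (rank_lt (@ideal_le_mono _ gens) rkP). Qed.

(** At rank [a] this is the definition of [x]. At smaller rank the primitive exists because the
    earlier stages have at most aleph_k generators, and adding the twist, a cocycle there, keeps it
    a primitive. *)
Lemma stage_eq a : equ (F a) k.+1 x (cobd (twisted a (tr a x) (b a))).
Proof.
elim/wlt_ind: a => a IH.
have xc : coc (Fl a) k.+1 (tr a x).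
  move=> f s Fs Rs ss.
  have [//|a' a'a Fa'] := All_Flt (@ideal_le_mono _ gens) _ Fs.
  rewrite (_ : cobd _ _ = cobd x (f :: s)).
    by apply: (cocycle_cobd (@Sfin_subgroup G) le_star_refl (@Sfin_le G) _ (IH a' a'a)).
  apply: eq_cobd => t ft; apply: tr_eq; last exact: drop1_All ft Fs.
  by move=> t0; have := drop1_size ft; rewrite t0 /= ss.
have yP : equ (Fl a) k.+1 (tr a x) (cobd (primitive a (tr a x))).
  exact: (@some_suchP _ _ (fun y => equ (Fl a) k.+1 (tr a x) (cobd y)) (Fl_acyclic xc)).
move=> f s Fs Rs [ss].
have /wle_eqVlt[ra|ra] := rank_le rkP Fs.
  by rewrite xP ra /stage subrr; case: (Sfin_subgroup G f).
have Fs' : All (Fl a) (f :: s).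
  by apply: All_imp (proj1 (rkP (F_Fall Fs))) => g; apply: F_Flt.
rewrite -(tr_eq _ Fs')//.
rewrite (_ : cobd (twisted _ _ _) _ = cobd (fun t => primitive a (tr a x) t + (if b a then twist
  a t else 0)) (f :: s)); last first.
  by apply: eq_cobd => t ft; rewrite /twisted asboolT//; apply: drop1_All ft Fs'.
rewrite cobdD opprD addrA; apply: (proj2 (Sfin_subgroup G f)); first by apply: yP => //; rewrite ss.
case: (b a); first exact: twist_cocycle.
by rewrite cobd0; case: (Sfin_subgroup G f).
Qed.

Lemma branch_cocycle : coc (ideal A) k.+1 x.
Proof.
move=> f s; rewrite -Fall_ideal => Fs.
have [a Fa] := All_Fall (omega_inh _) (@ideal_le_mono _ gens) Fs => Rs ss.
by apply: (cocycle_cobd (@Sfin_subgroup G) le_star_refl (@Sfin_le G) _ (@stage_eq a)).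
Qed.

(** A face that keeps [c a] is not contained in the earlier stages and gets the value zero; only the
    face omitting [c a] contributes. *)
Lemma branch_value a s : ~ Fl a (c a) -> All (Fl a) s -> size s = k ->
  x (rcons s (c a)) =
    (primitive a (tr a x) s + (if b a then twist a s else 0)) *~ (-1) ^+ k.
Proof.
move=> nF Fs sk.
have Fa : All (F a) (rcons s (c a)).
  apply/All_rcons; split; last exact: c_F.
  by apply: All_imp Fs => g; apply: FltW; exact: ideal_le_mono.
have ra : rk (rcons s (c a)) = a.
  have /wle_eqVlt[//|lt] := rank_le rkP Fa.
  have /All_rcons[_ Fc] := proj1 (rkP (F_Fall Fa)).
  by case: nF; exists (rk (rcons s (c a))).
rewrite xP ra /stage cobd_rcons sk (_ : (fun t => _) = fun=> 0) ?cobd0 ?add0r.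
  by rewrite /twisted asboolT.
by apply/funext => t; rewrite /twisted asboolF// => /All_rcons[].
Qed.

(* Coning off at c a, a trivialization of x agrees on the chain below a with
   the twisted primitive chosen at stage a, up to a coboundary. *)
Lemma branch_triv a (w : seq W -> ED) : ~ Fl a (c a) ->
  (forall i s, Srt (fun i j : W => wle i j) (i :: s) -> size s = k ->
    Sfin (c i) (push (x (map c (i :: s))) - cobd w (i :: s))) ->
  triv_below a (fun s => w s -
    push (primitive a (tr a x) (map c s) + (if b a then twist a (map c s) else 0))).
Proof.
move=> nF H; exists (fun t => - (w (rcons t a) *~ (-1) ^+ k)) => s sa ss sk.
have Rs : Srt (fun i j : W => wle i j) (rcons s a).
  by apply/Srt_rcons; split=> //; apply: All_imp sa => i; exact: wltW.
have := H (head a s) (behead (rcons s a)).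
have -> : head a s :: behead (rcons s a) = rcons s a by case: s {sa ss sk Rs}.
move=> /(_ Rs); rewrite size_behead size_rcons => /(_ sk).
rewrite map_rcons branch_value ?size_map//; last first.
  by apply/All_map; apply: All_imp sa => i; exact: c_Fl.
set Y := (X in X *~ _); move=> /(subgroup_sign k (Sfin_subgroup D _)).
move=> /(subgroupN (Sfin_subgroup D _)).
have eps (E : zmodType) (e : E) : e *~ (-1) ^+ k *~ (-1) ^+ k = e.
  by rewrite -mulrzA -exprD addnn -signr_odd odd_double mulr1z.
rewrite cobd_rcons sk cobdN cobdMz (raddfMz push) /= opprK mulrzBl mulrzDl !eps opprB.
by rewrite -/Y [X in X - _]addrC -addrA [X in _ + X]addrC !addrA; apply.
Qed.

End Branch.

Lemma tr_agree b b' x x' a : recursive rk 0 (stage b) x -> recursive rk 0 (stage b') x' ->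
  (forall i, wlt i a -> b i = b' i) -> tr a x = tr a x'.
Proof. by move=> xP xP' bb; apply: recursive_uniq xP xP' _ => z za; rewrite /stage bb. Qed.

End Ranked.

(** * Stages below which the chain is unbounded *)

Definition bound (s : seq W) : fn :=
  foldr (fun w f => fmax (fmax (c w) (some_such (c w) (fun f => A f /\ r f = w))) f) (fun=> 0%N) s.

Lemma bound_gens w f s : gens w f -> All (fun i => i <> w) s \/ le_star f (bound s).
Proof.
move=> gf; elim: s => [|i s [IH|IH]] /=; first by left.
  have [->|iw] := pselect (i = w); last by left.
  right; apply: le_star_trans (fmaxl _ _).
  case: gf => [->|[Af rf]]; first exact: fmaxl.
  apply: le_star_trans (fmaxr _ _).
  have [] := @some_suchP _ (c w) (fun f => A f /\ r f = w) (ex_intro _ f (conj Af rf)).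
  by move=> Ag rg; rewrite (rinj Af Ag) ?rf ?rg//; apply: le_star_refl.
by right; apply: le_star_trans IH (fmaxr _ _).
Qed.

Lemma bound_cat s t : le_star (bound s) (bound (s ++ t)) /\ le_star (bound t) (bound (s ++ t)).
Proof.
elim: s => [|i s [IH1 IH2]] /=; split.
- by apply/le_starP; exists 0%N.
- exact: le_star_refl.
- apply: fmax_lub; first exact: fmaxl.
  exact: le_star_trans IH1 (fmaxr _ _).
exact: le_star_trans IH2 (fmaxr _ _).
Qed.

(** Finite sequences of indices give cofinal elements of the ideal, so unboundedness of the chain
    below [a] can be obtained from closure of [a] under a function of finite sequences. *)
Lemma below_bound a p : ideal (below a) p ->
  exists2 s, All (fun i => wlt i a) s & le_star p (bound s).
Proof.
elim=> [f [b ba gf]|f g _ [s sa fs] _ [t ta gt]|f g fg _ [s sa gs]].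
- exists [:: b] => //; have [[]//|//] := @bound_gens b f [:: b] gf.
- exists (s ++ t); first by elim: s sa {fs} => //= i s IH [? /IH].
  have [H1 H2] := bound_cat s t.
  by apply: fmax_lub; [apply: le_star_trans fs H1 | apply: le_star_trans gt H2].
by exists s => //; apply: le_star_trans gs.
Qed.

Lemma bound_ideal s : ideal A (bound s).
Proof.
elim: s => [|w s IH] /=.
  have [w0] := omega_inh k.+1.
  by apply: ideal_down (cA w0); apply/le_starP; exists 0%N.
apply: ideal_join IH; apply: ideal_join => //; rewrite /some_such.
case: pselect => [h|_]; last exact: cA.
by case: (cid h) => f [Af _] /=; apply: ideal_gen.
Qed.

Definition unbounded_below a := forall p, ideal (below a) p ->
  exists2 i, wlt i a & ~ le_star (c i) p.

Lemma unbounded_below_notin a : unbounded_below a -> ~ Fl a (c a).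
Proof.
rewrite Fl_ideal => ub /ub[i ia]; apply; apply: cmono; exact: wltW.
Qed.

(** * Coding trivializations by bits and the guessing argument *)

Section Guess.
Variable cD : D -> nat.
Hypothesis cDinj : injective cD.
Hypothesis diamond : weak_diamond (Scof k).
Hypothesis twist_ex : forall a, Scof k a -> (exists i, wlt i a) -> unbounded_below a ->
  exists z, twistor a z.

Let idx_ex : exists f : seq W * nat -> W, injective f.
Proof.
have [f fi] : into W (fun _ : seq W * nat => True).
  apply: into_sub (into_seq_nat (infinite_omega k.+1) (into_T (ex_intro _ id (fun _ _ => id)))).
  by move=> z _; apply: All_true.
by exists f => x y; apply: fi.
Qed.

Let idx : seq W * nat -> W := projT1 (cid idx_ex).
Let idxinj : injective idx := projT2 (cid idx_ex).
Let key (s : seq W) (o : option (nat * nat * nat)) : W := idx (s, pickle o).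

Let key_inj s o s' o' : key s o = key s' o' -> s = s' /\ o = o'.
Proof. by move=> /idxinj[-> /(pcan_inj pickleK)]. Qed.

(** One function on [W] records both the bits [b], at the keys with [None], and the graph of [w], at
    those with [Some]. Countability of [D] makes the graph fit. *)
Definition code (b : W -> bool) (w : seq W -> ED) (u : W) : bool :=
  `[< (exists2 i, u = key [:: i] None & b i) \/
      exists s i j, u = key s (Some (i, j, cD (w s (i, j)))) >].

Definition code_bit (h : W -> bool) (i : W) : bool := h (key [:: i] None).

Definition code_fun (h : W -> bool) (s : seq W) : ED := fun p =>
  some_such 0 (fun d => h (key s (Some (p.1, p.2, cD d)))).

Lemma code_bitE b w i : code b w (key [:: i] None) = b i.
Proof.
apply/asboolP/idP => [[[j /key_inj[[->]]]//|]|bi]; last by left; exists i.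
by move=> [s [j [l /key_inj[]]]].
Qed.

Lemma code_funE b w s i j d :
  code b w (key s (Some (i, j, cD d))) <-> d = w s (i, j).
Proof.
split=> [/asboolP[[? /key_inj[]//]|]|->]; last by apply/asboolP; right; exists s, i, j.
by move=> [s' [i' [j' /key_inj[-> [-> -> /cDinj]]]]].
Qed.

Definition agree a (h h' : W -> bool) := forall u, wlt u a -> h u = h' u.

Lemma code_bit_agree a h b w i : agree a h (code b w) -> wlt (key [:: i] None) a ->
  code_bit h i = b i.
Proof. by move=> ah ia; rewrite /code_bit ah// code_bitE. Qed.

Lemma code_fun_agree a h b w s : agree a h (code b w) ->
  (forall o, wlt (key s o) a) -> code_fun h s = w s.
Proof.
move=> ah sa; apply/funext => -[i j]; rewrite /code_fun /=.
apply/(code_funE b); rewrite -ah//.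
apply: (@some_suchP _ 0 (fun d => h (key s (Some (i, j, cD d))))).
by exists (w s (i, j)); rewrite ah//; apply/code_funE.
Qed.

(** If every branch is trivial, take the branch of the guessing function [g] itself, with its
    trivialization [w g]. At a suitable stage [a] the bit [g a] says whether [w g] fits the
    untwisted primitive, while [w g] does fit the primitive twisted according to [g a]; both values
    are contradictory. *)
Lemma nontrivial_branch : exists x, coc (ideal A) k.+1 x /\
  ~ exists w, forall i s, Srt (fun i j : W => wle i j) (i :: s) -> size s = k ->
    Sfin (c i) (push (x (map c (i :: s))) - cobd w (i :: s)).
Proof.
apply: contrapT => /forallNP triv.
have [rk rkP] := rank_ex (omega_inh k.+1) (@ideal_le_mono _ gens).
have /choice[x xP] : forall b, exists x, recursive rk 0 (stage b) x.
  by move=> b; apply: recursive_ex.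
have /choice[w wP] : forall b, exists w, forall i s,
    Srt (fun i j : W => wle i j) (i :: s) -> size s = k ->
    Sfin (c i) (push (x b (map c (i :: s))) - cobd w (i :: s)).
  move=> b; apply: contrapT => nw; apply: (triv (x b)).
  by split; [exact: (branch_cocycle rkP (xP b)) | exact: nw].
pose prim a b s := primitive a (trunc rk (0 : EG) a (x b)) (map c s).
pose guess a b (v : seq W -> ED) := triv_below a (fun s => v s - push (prim a b s)).
have guess_agree a b b' v v' : (forall i, wlt i a -> b i = b' i) ->
    (forall s, All (fun i => wlt i a) s -> v s = v' s) -> guess a b v -> guess a b' v'.
  move=> bb vv; rewrite /guess /prim (tr_agree (xP b) (xP b') bb).
  by apply: eq_triv_below => s sa; rewrite vv.
pose ext a (h : set_type (wseg a) -> bool) (u : W) : bool :=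
  if insub u is Some u' then h u' else false.
(* The function to be guessed asks whether the decoded trivialization fits the untwisted primitive
   of the decoded branch below [a]. *)
have [g gP] := diamond (fun a h => `[< guess a (code_bit (ext a h)) (code_fun (ext a h)) >]).
have /choice[ub ubP] : forall s, exists i, ~ le_star (c i) (bound s).
  by move=> s; apply: cunb; apply: bound_ideal.
(* Closure under [phi] at second argument 0 makes the chain unbounded below [a]; at successors it
   keeps the keys of sequences below [a] below [a]. *)
pose phi (z : seq W * nat) := if z.2 is m.+1 then idx (z.1, m) else ub z.1.
have [a [[Sa ga] [a0 aphi]]] := gP (code g (w g)) _ (club_closed (infinite_omega k) phi).
have ua : unbounded_below a.
  move=> p /below_bound[s sa ps]; exists (ub s); first exact: (aphi s 0%N).
  by move=> up; apply: (ubP s); apply: le_star_trans ps.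
have key_lt s o : All (fun i => wlt i a) s -> wlt (key s o) a.
  by move=> sa; exact: (aphi s (pickle o).+1).
have nF := unbounded_below_notin ua.
set h := ext a _ in ga.
have ah : agree a h (code g (w g)).
  move=> u ua'; rewrite /h /ext.
  have uin : u \in wseg a by apply/mem_set.
  by rewrite (insubT (fun u => u \in wseg a) uin).
have gaE : g a <-> guess a g (w g).
  rewrite ga; split=> [/asboolP|H]; last apply/asboolP.
    apply: guess_agree => [i ia|s sa].
      by apply: code_bit_agree ah (key_lt _ _ _).
    by apply: code_fun_agree ah _ => o; apply: key_lt.
  apply: guess_agree H => [i ia|s sa]; symmetry.
    by apply: code_bit_agree ah (key_lt _ _ _).
  by apply: code_fun_agree ah _ => o; apply: key_lt.
have tw := branch_triv rkP (xP g) nF (wP g).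
have [zc] := some_suchP (fun=> 0) (twist_ex Sa a0 ua); apply.
(* Bit 1: [w g] fits both primitives, so their difference, the twist, would be trivial. Bit 0: [w g]
   fits the untwisted primitive, which forces the bit to be 1. *)
case: (boolP (g a)) (gaE) tw => [_ [/(_ isT) gu _]|_ [_ gu]] tw.
  apply: eq_triv_below (triv_belowB gu tw) => s _.
  by rewrite /prim (raddfD push) /= subrACA subrr sub0r opprB addrAC subrr add0r.
have : false; last by [].
apply: gu; apply: eq_triv_below tw => s _.
by rewrite addr0.
Qed.

End Guess.
End Twist.

(** * Existence of twists by induction on the dimension *)

Section Chains.
Variables (G D : zmodType) (pi : {additive G -> D}) (g0 : G).
Hypothesis pig0 : pi g0 != 0.
Variable cD : D -> nat.
Hypothesis cDinj : injective cD.

(** [chi] is supported on points (q m, p m (q m)) just outside the region of [p m] but inside that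
    of [f], with q m at least m. As the sequence [p] increases, only those with m < l lie in the
    region of [p l]. *)
Lemma almost_disjoint (B : fn -> Prop) (f : fn) : into nat B -> (exists p, B p) ->
  (forall p, ideal B p -> ~ le_star f p) ->
  exists chi : nat * nat -> G, (forall p, ideal B p -> Sfin p chi) /\ ~ Sfin f (push pi chi).
Proof.
move=> Bnat exB nf; have [p [pB pmono pcof]] := countable_cofinal Bnat exB.
have /choice[q qP] : forall k, exists i, (k <= i)%N /\ (p k i < f i)%N.
  move=> k; apply: contrapT => /forallNP H; apply: (nf _ (pB k)).
  apply/le_starP; exists k => i ki; rewrite leqNgt; apply/negP => pf.
  by apply: (H i).
exists (fun u => if `[< exists m, u = (q m, p m (q m)) >] then g0 else 0); split.
  move=> h /pcof[l hl]; apply: Sfin_le hl _.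
  exists (\max_(m < l) q m).+1 => i j Ni ji; rewrite asboolF// => -[m [im jm]].
  have ml : (m < l)%N.
    rewrite ltnNge; apply/negP => lm; move: ji; rewrite jm -im ltnNge.
    by rewrite pmono.
  by move: Ni; rewrite im ltnNge (leq_bigmax (Ordinal ml)).
move=> [N /(_ (q N) (p N (q N)))]; have [Nq pq] := qP N => /(_ Nq pq) /eqP.
by rewrite /push asboolT ?(negPf pig0)//; exists N.
Qed.

(** A twist at [a] comes from the same statement one dimension lower, applied to a cofinal sequence
    of the chain below [a]; in the lowest dimension it is the function [chi] of
    [almost_disjoint]. *)
Lemma chain_nontrivial k : (forall j, (j <= k)%N -> weak_diamond (Scof j)) ->
  forall (A : fn -> Prop) (c : omega k.+1 -> fn), into (omega k.+1) A ->
  (forall i j, wle i j -> le_star (c i) (c j)) -> (forall i, ideal A (c i)) ->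
  (forall p, ideal A p -> exists i, ~ le_star (c i) p) ->
  exists x, cocycle_on (@Sfin G) le_star (ideal A) k.+1 x /\
  ~ exists w, forall i s, Srt (fun i j : omega k.+1 => wle i j) (i :: s) -> size s = k ->
    Sfin (c i) (push pi (x (map c (i :: s))) - cobd w (i :: s)).
Proof.
elim: k => [|k IH] WD A c [r rinj] cmono cA cunb.
  apply: (nontrivial_branch rinj cmono cA cunb cDinj (WD 0%N isT)) => a Sa [i ia] ua.
  have [||f If|chi [chiB chi0]] := @almost_disjoint (below A r c a) (c a).
  - exact: (below_into (k := 0) c rinj).
  - by exists (c i), i => //; left.
  - by have [j ja nj] := ua _ If => ?; apply: nj; apply: le_star_trans (cmono _ _ (wltW ja)) _.
  exists (fun=> chi); split.
    by rewrite Fl_ideal => f s [If _] _ /size0nil -> /=; rewrite subr0; apply: chiB.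
  move=> [v /(_ [::] I I erefl)]; rewrite /= subr0; exact: chi0.
apply: (nontrivial_branch rinj cmono cA cunb cDinj (WD k.+1 (leqnn _))) => a Sa _ ua.
have [q [qmono qa qcof]] := Scof_cofinal Sa.
have [|||||z [zc znt]] := IH _ (below A r c a) (c \o q).
- by move=> j jk; apply: WD; apply: leqW.
- exact: below_into.
- by move=> i j ij; apply: cmono; apply: qmono.
- by move=> i; apply: ideal_gen; exists (q i) => //; left.
- move=> p /ua[i /qcof[j ij] ip]; exists j => /= jp; apply: ip.
  by apply: le_star_trans jp; apply: cmono.
exists z; split; first by rewrite Fl_ideal.
move=> [v vP]; apply: znt; exists (v \o map q) => i s ss sk.
have := vP (map q (i :: s)); rewrite -map_comp -cobd_map; apply.
- by apply/All_map; apply: All_true.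
- by apply/Srt_map; apply: Srt_sub ss.
by rewrite size_map /= sk.
Qed.

End Chains.

(** * The families of the paper *)

(** Links the recursion on lists with the indexed alternating sum in [delta]. *)
Lemma cobd_ord U (E : zmodType) (x : seq U -> E) m (t : 'I_m.+1 -> U) :
  cobd x (map t (enum 'I_m.+1)) =
    \sum_(k < m.+1) x (map (fun i => t (lift k i)) (enum 'I_m)) *~ (-1) ^+ k.
Proof.
elim: m x t => [|m IH] x t.
  rewrite big_ord1 enum_ordSl /= -map_comp.
  have -> : enum 'I_0 = [::] by apply: size0nil; rewrite size_enum_ord.
  by rewrite /= subr0 mulr1z.
rewrite enum_ordSl /= -map_comp big_ord_recl mulr1z; congr (_ + _).
rewrite IH -sumrN; apply: eq_bigr => k _.
rewrite -mulrNz; congr (x _ *~ _); last by rewrite /= exprS mulN1r.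
rewrite [in RHS]enum_ordSl /= -map_comp; congr (t _ :: _); first exact: val_inj.
apply: eq_map => i /=; congr t; apply: val_inj => /=.
by rewrite /bump /= !add1n ltnS addnS.
Qed.

Section Translation.
Variable G : zmodType.
Notation EG := (nat * nat -> G).

Lemma SfinP f (e : EG) :
  Sfin f e <-> finite_set [set p : nat * nat | (p.2 < f p.1)%N /\ e p <> 0].
Proof.
split=> [[N eN]|].
  apply: (@sub_finite_set _ _ (`I_N `*` `I_(\max_(i < N) f i))) => [[i j] /= [ji eij]|].
    have iN : (i < N)%N by rewrite ltnNge; apply/negP => Ni; apply: eij; apply: eN.
    split=> //; apply: leq_trans ji _; exact: (leq_bigmax (Ordinal iN)).
  exact: finite_setX (finite_II _) (finite_II _).
move=> fin; have /cofiniteP[N NP] : cofinite_set (~` [set p.1 | p in [set p : nat * nat | (p.2 <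
  f p.1)%N /\ e p <> 0]]).
  by rewrite setCK; apply: finite_image.
exists N => i j /NP Ni ji; apply: contrapT => eij; apply: Ni.
by exists (i, j).
Qed.

Definition cutoff f (e : EG) : Idx f -> G := fun u => e (val u).

Arguments cutoff : clear implicits.

Lemma cutoff_zmod f : zmod_morphism (cutoff f).
Proof. by []. Qed.

HB.instance Definition _ f :=
  GRing.isZmodMorphism.Build EG (Idx f -> G) (cutoff f) (@cutoff_zmod f).

Definition toQ f (e : EG) : Q G f := \pi_(Q G f)%qT (cutoff f e).

Lemma toQ_eq f d e : toQ f d = toQ f e <-> Sfin f (d - e).
Proof.
rewrite SfinP; split=> [/eqP|fin].
  rewrite -Quotient.idealrBE => /asboolP fin.
  apply: (sub_finite_set _ (finite_image val fin)) => p /= [pf dep].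
  by exists (exist _ p pf) => //=; apply/eqP.
apply/eqP; rewrite -Quotient.idealrBE; apply/asboolP.
apply: (@sub_finite_set _ _ ((val : Idx f -> nat * nat) @^-1` [set p : nat * nat | (p.2 < f
  p.1)%N /\ (d - e) p <> 0])).
  by move=> u /= /eqP; split=> //; exact: (valP u).
by apply: (finite_preimage _ fin) => u v _ _; apply: val_inj.
Qed.

Definition tseq P m (t : incr P m) : seq fn := map t (enum 'I_m.+1).

Lemma tseqE P m (t : incr P m) : tseq t = t ord0 :: map (fun i => t (lift ord0 i)) (enum 'I_m).
Proof. by rewrite /tseq enum_ordSl /= -map_comp. Qed.

Lemma tseq_Srt P m (t : incr P m) : Srt le_star (tseq t).
Proof.
case: t => t tP tle; rewrite /tseq /= {tP}.
elim: m t tle => [|m IH] t tle; rewrite enum_ordSl /=; split.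
- by rewrite (_ : enum _ = [::])//; apply: size0nil; rewrite size_enum_ord.
- by rewrite (_ : enum _ = [::])//; apply: size0nil; rewrite size_enum_ord.
- by apply/All_map/All_map; apply: All_true => i; apply: tle.
rewrite -map_comp; apply: IH => i j ij; apply: tle.
by rewrite leq_bump2.
Qed.

Lemma tseq_ex P m s : All P s -> Srt le_star s -> size s = m.+1 ->
  exists t : incr P m, tseq t = s.
Proof.
move=> Ps Rs ss.
pose t (i : 'I_m.+1) := nth (fun=> 0%N) s i.
have allP (Q : fn -> Prop) s' j : All Q s' -> (j < size s')%N -> Q (nth (fun=> 0%N) s' j).
  elim: s' j => // a s' IH [|j] [Qa Qs] //=; exact: IH.
have tP i : P (t i) by apply: allP; rewrite ?ss.
have tle (i j : 'I_m.+1) : (i <= j)%N -> le_star (t i) (t j).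
  rewrite /t; move: (nat_of_ord i) (nat_of_ord j) (ltn_ord j) => {tP i j t}i j; rewrite -ss.
  elim: s i j Rs {Ps ss} => // a s IH [|i] [|j] [Ra Rs] //= js ij.
  - exact: le_star_refl.
  - exact: allP.
  - exact: IH.
exists (Incr tP tle); rewrite /tseq /= /t -[RHS](@mkseq_nth _ (fun=> 0%N)) ss.
by rewrite /mkseq -val_enum_ord -map_comp.
Qed.

Lemma tseq_inj P m : injective (@tseq P m).
Proof.
move=> [t tP tle] [t' tP' tle'] E.
have {}E : t = t'.
  apply/funext => i; have : i \in enum 'I_m.+1 by rewrite mem_enum.
  move: E; rewrite /tseq /=; elim: (enum _) => // a s IH [ta ts].
  by rewrite inE => /orP[/eqP->|/(IH ts)].
by subst t'; congr Incr; exact: Prop_irrelevance.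
Qed.

(** The extension by zero in [restr] differs from plain restriction only on I_f minus I_g, which is
    finite for f below g modulo finite. *)
Lemma delta_tseq P m (y : K G P m) (Y : seq fn -> EG) :
  (forall t, y t = toQ (t ord0) (Y (tseq t))) ->
  forall t, delta y t = toQ (t ord0) (cobd Y (tseq t)).
Proof.
move=> yY t; rewrite /delta /toQ.
have -> : cutoff (t ord0) (cobd Y (tseq t)) =
    \sum_(k < m.+2) cutoff (t ord0) (Y (tseq (face k t))) *~ (-1) ^+ k.
  by rewrite /tseq cobd_ord raddf_sum; apply: eq_bigr => k _; rewrite raddfMz.
rewrite raddf_sum; apply: eq_bigr => k _; rewrite raddfMz; congr (_ *~ _).
rewrite yY proj_pi; set f := t ord0; set g := face k t ord0; set e := Y _.
have fg : le_star f g by apply: tup_le.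
apply/eqP; rewrite -Quotient.idealrBE; apply/asboolP.
have /SfinP fin : Sfin f (fun p => if (p.2 < g p.1)%N then 0 else e p).
  have /le_starP[N NP] := fg; exists N => i j /NP fgi ji /=.
  by rewrite ifT//; apply: leq_trans fgi.
apply: (@sub_finite_set _ _ ((val : Idx f -> nat * nat) @^-1` _)); last first.
  by apply: (finite_preimage _ fin) => u v _ _; apply: val_inj.
move=> u /= nz; split; first exact: (valP u).
move: nz; rewrite [X in X != 0]/GRing.add /= [X in _ + X]/GRing.opp /= /restr /cutoff.
case: insubP => [v _ <-|/negbTE ->]; first by rewrite subrr eqxx.
by rewrite sub0r oppr_eq0 => /eqP.
Qed.

Definition cfamily_of (n : nat) : (seq fn -> EG) -> cfamily G n [set: fn] :=
  match n with
  | m.+2 => fun x (t : incr [set: fn] m.+1) => toQ (t ord0) (x (tseq t))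
  | _ => fun x f _ => cutoff f (x [:: f])
  end.

Lemma cfamily_of_coherent n x : (0 < n)%N -> cocycle_on (@Sfin G) le_star [set: fn] n x ->
  coherent (cfamily_of n x).
Proof.
case: n => // -[|m] _ cx.
  have xfg f g : le_star f g -> Sfin f (x [:: g] - x [:: f]).
    by move=> fg; have := cx f [:: g]; rewrite /= subr0; apply.
  (* Two arbitrary indices are compared through their maximum. *)
  move=> f g Pf Pg; have [N1 E1] := (proj1 (Sfin_sub _ _ _)) (xfg _ _ (fmaxl f g)).
  have [N2 E2] := (proj1 (Sfin_sub _ _ _)) (xfg _ _ (fmaxr f g)).
  have /SfinP : Sfin f (fun p => if (p.2 < g p.1)%N then x [:: f] p - x [:: g] p else 0).
    exists (maxn N1 N2) => i j; rewrite geq_max => /andP[i1 i2] jf /=.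
    by case: ifP => // jg; rewrite -E1// -E2// subrr.
  apply: sub_finite_set => p /= [pf [pg ne]]; split=> //.
  by rewrite pg => /eqP; rewrite subr_eq0 => /eqP.
move=> t /=; rewrite (@delta_tseq _ _ _ x)//.
have -> : 0 = toQ (t ord0) 0 by rewrite /toQ !raddf0.
apply/toQ_eq; rewrite subr0; have := tseq_Srt t; rewrite tseqE => st; apply: cx => //.
  by apply: All_true.
by rewrite size_map size_enum_ord.
Qed.

(** Representatives are chosen and extended by zero to the plane. A list determines its tuple, so
    this defines a function of lists, with default 0. *)
Lemma K_lift C m (y : K G C m) :
  exists Y : seq fn -> EG, forall t, y t = toQ (t ord0) (Y (tseq t)).
Proof.
suff /choice[Y YP] : forall s, exists e, forall t : incr C m, tseq t = s -> y t = toQ (t ord0) e.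
  by exists Y => t; apply: YP.
move=> s; have [[t ts]|nt] := pselect (exists t : incr C m, tseq t = s); last first.
  by exists 0 => t ts; case: nt; exists t.
exists (fun p => if insub p is Some u then repr (y t) u else 0) => t'.
rewrite -ts => /tseq_inj ->; rewrite /toQ (_ : cutoff _ _ = repr (y t)) ?reprK//.
by apply/funext => u; rewrite /cutoff valK.
Qed.

Lemma cfamily_of_nontrivial n x (W : woset) (c : W -> fn) (C : set fn) :
  (forall i j, wle i j -> le_star (c i) (c j)) -> (forall i, C (c i)) ->
  ~ (exists w, forall i s, Srt (fun i j : W => wle i j) (i :: s) -> size s = n ->
    Sfin (c i) (x (map c (i :: s)) - cobd w (i :: s))) ->
  nontrivial_on (@subsetT _ C) (cfamily_of n.+1 x).
Proof.
move=> cmono Cc nw; case: n nw => [|m] nw /=.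
  move=> [psi psiP]; apply: nw; exists (fun=> psi) => i s _ /size0nil ->; rewrite /= subr0.
  apply/SfinP; apply: (sub_finite_set _ (finite_image val (psiP _ (Cc i)))) => p /= [pf ne].
  exists (exist _ p pf) => //= E; apply: ne.
  by rewrite [LHS]/GRing.add /= [X in _ + X]/GRing.opp /= E subrr.
move=> [y yP]; have [Y YP] := K_lift y; apply: nw.
exists (fun s => Y (map c s)) => i s ss sn.
have [|||t tE] := @tseq_ex C m.+1 (map c (i :: s)).
- by apply/All_map; apply: All_true.
- by apply/Srt_map; apply: Srt_sub ss => a b; apply: cmono.
- by rewrite size_map /= sn.
have := yP t; rewrite (delta_tseq YP) => /esym /toQ_eq.
rewrite -[tseq (incr_sub _ _)]/(tseq t) tE -(cobd_map c Y (i :: s)).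
by rewrite tseqE in tE; case: tE => ->.
Qed.

End Translation.
Arguments cutoff {G} f e.

(** * Change of index category *)

Lemma fct_subE I (E : zmodType) (u v : I -> E) i : (u - v) i = u i - v i.
Proof. by []. Qed.

Lemma cobd_app U I (E : zmodType) (u : seq U -> I -> E) s i :
  cobd u s i = cobd (fun t => u t i) s.
Proof.
elim: s u => [//|a s IH] u /=.
by rewrite fct_subE IH.
Qed.

(** Coning with the minimum as new first entry; as this changes the first entry, the coefficients
    are taken constant. *)
Lemma acyclic_min U (E : zmodType) (S : E -> Prop) (L : U -> U -> Prop) (T : U -> Prop) n m :
  subgroup S -> (forall f, T f -> L m f) -> T m -> acyclic (fun=> S) L T n.
Proof.
move=> Sg Lm Tm x cx; exists (fun t => x (m :: t)) => a s Ts Ls ss.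
apply: (cx m (a :: s)) => //; split=> //; exact: All_imp Ts.
Qed.

Section Comparison.
Variables (U : Type) (R L : U -> U -> Prop) (T V : U -> Prop).
Hypothesis Rxx : forall f, R f f.
Hypothesis Rtr : forall g f h, R f g -> R g h -> R f h.
Hypothesis LR : forall f g, L f g -> R f g.
Hypothesis VT : forall f, V f -> T f.
Hypothesis cof : forall h, T h -> exists2 g, V g & R h g.
Hypothesis above_acyclic : forall h, T h -> forall n (E : zmodType) (S : E -> Prop),
  subgroup S -> (0 < n)%N -> acyclic (fun=> S) L (fun f => V f /\ R h f) n.

Lemma Srt_cons h a s : R h a -> Srt R (a :: s) -> Srt R (h :: a :: s).
Proof.
move=> ha ass; split=> //; split=> //; case: ass => as_ _.
by apply: All_imp as_ => b; exact: Rtr.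
Qed.

(* Dimension shifting along M -> prod_(h <= f) M_h; the quotient of the
   coinduced system by M is again of the form E' / S' f. *)
Lemma comparison n (E : zmodType) (S : U -> E -> Prop) x y :
  (forall f, subgroup (S f)) -> (forall f g e, R f g -> S g e -> S f e) -> (0 < n)%N ->
  cocycle_on S R T n x -> eq_on S L V n x (cobd y) -> exists y, eq_on S R T n x (cobd y).
Proof.
elim: n E S x y => // -[_|n IH] E S x y Sg SR _ cx xy.
  exists y => f s [Tf _] _ [/size0nil ->] /=.
  have [g Vg fg] := cof Tf.
  apply: (subgroup_trans (b := x [:: g])) => //.
    have := cx f [:: g]; rewrite /= subr0 => H; apply: subgroupC => //; apply: H => //.
    by do !split=> //; exact: VT.
  by apply: SR fg _; have := xy g [::]; apply.
(* Functions of [h] that below [f] agree, modulo each [S h], with one element of E: the image of the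
   original system in the coinduced one. *)
pose S' f (phi : U -> E) := exists e, forall h, T h -> R h f -> S h (phi h - e).
have Sg' f : subgroup (S' f).
  split; first by exists 0 => h _ _; rewrite subrr; case: (Sg h).
  move=> a b [d da] [e eb]; exists (d - e) => h Th hf.
  by rewrite fct_subE subrACA; apply: (proj2 (Sg h)); auto.
have SR' f g e : R f g -> S' g e -> S' f e.
  by move=> fg [d de]; exists d => h Th hf; apply: de => //; apply: Rtr fg.
pose u s h := x (h :: s).
have cone h a s : T h -> R h a -> All T (a :: s) -> Srt R (a :: s) -> size s = n.+1 ->
    S h (x (a :: s) - cobd (fun t => x (h :: t)) (a :: s)).
  move=> Th ha Ts Rs ss; apply: (cx h (a :: s)) => //; last by rewrite /= ss.
  exact: Srt_cons.
have cu : cocycle_on S' R T n.+1 u.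
  move=> a s Ts Rs ss; exists (x (a :: s)) => h Th ha; rewrite cobd_app.
  by apply: subgroupC => //; apply: cone.
(* For fixed [h], [u] and [y] are both primitives of [x] on the [L]-tuples of [V] above [h], so they
   differ by a cocycle with constant coefficients. *)
have /choice[v vP] : forall h, exists v, T h ->
    eq_on (fun=> S h) L (fun f => V f /\ R h f) n.+1 (fun s => u s h - y s) (cobd v).
  move=> h; have [Th|nT] := pselect (T h); last by exists y.
  suff /(above_acyclic Th (Sg h) (ltn0Sn n))[v vP] :
      cocycle_on (fun=> S h) L (fun f => V f /\ R h f) n.+1 (fun s => u s h - y s) by exists v.
  move=> a s Ts Ls ss; rewrite cobd_zmod.
  have Rs := Srt_sub LR Ls; have Vs : All V (a :: s) by apply: All_imp Ts => f [].
  have ha : R h a by case: Ts => -[].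
  apply: (subgroup_trans (b := x (a :: s))) => //.
    by apply: subgroupC => //; apply: cone => //; apply: All_imp Vs.
  by apply: SR ha _; apply: xy => //; rewrite ss.
have uv : eq_on S' L V n.+1 u (cobd (fun s h => v h s)).
  move=> a s Vs Ls ss; exists (y (a :: s)) => h Th ha.
  rewrite fct_subE cobd_app addrAC; apply: vP => //.
  by apply: All_and Vs _; case: (Srt_cons ha (Srt_sub LR Ls)).
have [w wP] := IH _ _ _ _ Sg' SR' isT cu uv.
(* By the choice of [S'], [u - cobd w] is represented by a single element independent of [h]; this
   element is the new primitive. *)
have /choice[y' y'P] : forall s, exists e, forall a t, s = a :: t -> All T s -> Srt R s ->
    size t = n -> forall h, T h -> R h a -> S h ((u s - cobd w s) h - e).
  move=> s; have [[[a t] [sE Ts Rs st]]|ns] := pselect (exists at_ : U * seq U,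
     [/\ s = at_.1 :: at_.2, All T s, Srt R s & size at_.2 = n]); last first.
    by exists 0 => a t sE Ts Rs st; case: ns; exists (a, t).
  move: sE st Ts Rs => /= -> st Ts Rs; have [e eP] := wP a t Ts Rs (congr1 succn st).
  by exists e => b t' [<- _] _ _ _ h; apply: eP.
exists y' => a s Ts Rs [ss].
have Ta : T a by case: Ts.
(* The cone over the first entry itself exhibits [x] as the coboundary of coordinate [a] of [u];
   subtracting [cobd w] does not change that coboundary. *)
have cc := cone a a s Ta (Rxx a) Ts Rs ss.
apply: (subgroup_trans (b := cobd (fun t => x (a :: t)) (a :: s))) => //.
rewrite (_ : cobd _ (a :: s) = cobd (fun t => (u t - cobd w t) a) (a :: s)); last first.
  have := congr1 (fun e : U -> E => e a) (cobdK w (a :: s)).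
  by rewrite cobd_app (cobd_zmod (fun t => u t a)) => ->; rewrite subr0.
rewrite -cobd_zmod.
apply: cobd_ind; [by case: (Sg a) | by case: (Sg a) |].
case=> [/drop1_size/=|b t ft]; first by rewrite ss.
apply: (y'P (b :: t) b t erefl).
- exact: drop1_All ft Ts.
- exact: drop1_Srt ft Rs.
- by have := drop1_size ft; rewrite /= ss => -[].
- exact: Ta.
- exact: drop1_head Rxx Rs ft.
Qed.

End Comparison.

(** * From the pointwise order to the order modulo finite *)

Section Pointwise.
Definition le_all (f g : fn) : Prop := forall i, (f i <= g i)%N.

Lemma le_all_star f g : le_all f g -> le_star f g.
Proof. by move=> fg; apply/le_starP; exists 0%N => i _; apply: fg. Qed.

Lemma le_all_refl f : le_all f f. Proof. by []. Qed.

Lemma le_all_trans g f h : le_all f g -> le_all g h -> le_all f h.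
Proof. by move=> fg gh i; apply: leq_trans (fg i) (gh i). Qed.

Lemma le_all_fmax f g h : le_all f h -> le_all g h -> le_all (fmax f g) h.
Proof. by move=> fh gh i; rewrite geq_max fh gh. Qed.

(** The functions pointwise above [h] have the minimum [h] and are cofinal among those above [h]
    modulo finite. [comparison] applies, since those also above a given [f] have the minimum
    [fmax h f]. *)
Lemma le_all_acyclic h n (E : zmodType) (S : E -> Prop) : subgroup S -> (0 < n)%N ->
  acyclic (fun=> S) le_all (le_star h) n.
Proof.
move=> Sg n0 x cx; pose V f := le_all h f.
have [y yP] : exists y, eq_on (fun=> S) le_all V n x (cobd y).
  apply: (@acyclic_min _ _ S le_all V n h Sg) => // a s Vs; apply: cx.
  by apply: All_imp Vs; exact: le_all_star.
have Vcof f : le_star h f -> exists2 g, V g & le_all f g.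
  move=> hf; exists (fmax h f) => i; first exact: leq_maxl.
  exact: leq_maxr.
apply: (comparison le_all_refl (fun g f1 f2 => @le_all_trans g f1 f2) (fun f g => id)
  (fun f => @le_all_star h f) Vcof _ (fun=> Sg) (fun _ _ _ _ => id) n0 cx yP).
move=> f hf m E' S' Sg' m0; apply: (@acyclic_min _ _ _ _ _ _ (fmax h f)) => //.
  by move=> g [hg fg]; apply: le_all_fmax.
by split=> i; [apply: leq_maxl | apply: leq_maxr].
Qed.

Lemma comparison_star n (E : zmodType) (S : fn -> E -> Prop) x y :
  (forall f, subgroup (S f)) -> (forall f g e, le_star f g -> S g e -> S f e) -> (0 < n)%N ->
  cocycle_on S le_star (fun=> True) n x -> eq_on S le_all (fun=> True) n x (cobd y) ->
  exists y, eq_on S le_star (fun=> True) n x (cobd y).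
Proof.
apply: (comparison le_star_refl (fun g f h => @le_star_trans g f h) le_all_star (fun f => id)
  (fun h _ => ex_intro2 _ _ h I (le_star_refl h))).
move=> h _ m E' S' Sg' m0 z cz.
have [|v vP] := @le_all_acyclic h m E' S' Sg' m0 z.
  by move=> a s hs; apply: cz; apply: All_imp hs.
by exists v => a s hs; apply: vP; apply: All_imp hs => ? [].
Qed.

Variable G : zmodType.
Notation EG := (nat * nat -> G).

(** At each point of the plane [x - a] is an exact cocycle on the functions whose region contains
    the point; these have a least element, and coning with it gives a primitive. *)
Lemma trivial_of_dsum n (x a : seq fn -> EG) : (0 < n)%N ->
  cocycle_on (@Sfin G) le_star (fun=> True) n x ->
  (forall f s, Srt le_all (f :: s) -> (size s).+1 = n -> Sfin f (a (f :: s))) ->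
  (forall f s, Srt le_all (f :: s) -> size s = n ->
     forall i j, (j < f i)%N -> cobd a (f :: s) (i, j) = cobd x (f :: s) (i, j)) ->
  exists y, eq_on (@Sfin G) le_star (fun=> True) n x (cobd y).
Proof.
move=> n0 cx afin ax.
(* [e p] is the least function whose region contains [p]; the successor is due to the strict
   inequality defining I_f. *)
pose e (p : nat * nat) : fn := fun i => if i == p.1 then p.2.+1 else 0%N.
apply: (comparison_star (y := fun s p => x (e p :: s) p - a (e p :: s) p)) => //.
- exact: Sfin_subgroup.
- exact: Sfin_le.
move=> f s _ Ls ss.
have -> : x (f :: s) - cobd (fun s p => x (e p :: s) p - a (e p :: s) p) (f :: s) =
   (x (f :: s) - a (f :: s) - cobd (fun s p => x (e p :: s) p - a (e p :: s) p) (f :: s)) + a (f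
     :: s).
  by rewrite addrAC subrK.
apply: (subgroupD (Sfin_subgroup _ _)); last exact: afin.
exists 0%N => i j _ jf; rewrite fct_subE cobd_app /=.
have ef : le_all (e (i, j)) f by move=> i'; rewrite /e /=; case: eqP => [->|].
have eLs : Srt le_all (e (i, j) :: f :: s).
  by apply: Srt_cons ef Ls => g f1 f2; exact: le_all_trans.
have := ax (e (i, j)) (f :: s) eLs ss i j.
rewrite {1}/e /= eqxx => /(_ (ltnSn _)); set E := e (i, j).
rewrite !fct_subE !cobd_app.
have cancel (p q r p' q' r' : G) : p - (q - r) = p' - (q' - r') ->
    p' - p - (q' - q - (r' - r)) = 0.
  by move=> H; rewrite (subrACA q') (subrACA p') H subrr.
by move=> /cancel; rewrite cobd_zmod.
Qed.

End Pointwise.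

(** * Products of groups and coinduced systems *)

Definition dprod (I : Type) (M : I -> zmodType) : Type := forall i, M i.

Section DependentProduct.
Variables (I : Type) (M : I -> zmodType).
Notation P := (dprod M).

HB.instance Definition _ := gen_eqMixin P.
HB.instance Definition _ := gen_choiceMixin P.

Definition dprod_add (u v : P) : P := fun i => u i + v i.
Definition dprod_opp (u : P) : P := fun i => - u i.
Definition dprod_zero : P := fun i => 0.

Lemma dprod_addA : associative dprod_add.
Proof. by move=> u v w; apply: functional_extensionality_dep => i; exact: addrA. Qed.
Lemma dprod_addC : commutative dprod_add.
Proof. by move=> u v; apply: functional_extensionality_dep => i; exact: addrC. Qed.
Lemma dprod_add0 : left_id dprod_zero dprod_add.
Proof. by move=> u; apply: functional_extensionality_dep => i; exact: add0r. Qed.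
Lemma dprod_addN : left_inverse dprod_zero dprod_opp dprod_add.
Proof. by move=> u; apply: functional_extensionality_dep => i; exact: addNr. Qed.

HB.instance Definition _ :=
  GRing.isZmodule.Build P dprod_addA dprod_addC dprod_add0 dprod_addN.

Lemma dprodB (u v : P) i : (u - v) i = u i - v i.
Proof. by []. Qed.

Lemma cobd_dprod U (u : seq U -> P) s i : cobd u s i = cobd (fun t => u t i) s.
Proof. by elim: s u => [//|a s IH] u /=; rewrite dprodB IH. Qed.

End DependentProduct.

Section Systems.
Context {d : Order.disp_t} {T : porderType d}.
Implicit Types (f g h : T) (s t : seq T).

Definition down f := {h : T | (h <= f)%O}.

Definition down_le f g (fg : (f <= g)%O) (z : down f) : down g :=
  exist _ (val z) (le_trans (valP z) fg).

Section Coinduced.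
Variable N : T -> zmodType.

Definition coind_obj f : zmodType := dprod (fun z : down f => N (val z)).

Definition coind_bond f g (fg : (f <= g)%O) (phi : coind_obj g) : coind_obj f :=
  fun z => phi (down_le fg z).

Lemma coind_bond_zmod f g fg : zmod_morphism (@coind_bond f g fg).
Proof. by []. Qed.

HB.instance Definition _ f g fg := GRing.isZmodMorphism.Build (coind_obj g) (coind_obj f)
  (@coind_bond f g fg) (@coind_bond_zmod f g fg).

Lemma coind_irr f (x : coind_obj f) h (p q : (h <= f)%O) :
  x (exist _ h p) = x (exist _ h q) :> N h.
Proof. by rewrite (bool_irrelevance p q). Qed.

Lemma coind_bond_id f (ff : (f <= f)%O) x : coind_bond ff x = x.
Proof.
apply: functional_extensionality_dep => -[h p];
  exact: (@coind_irr f x h (le_trans (valP (exist _ h p)) ff) p).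
Qed.

Lemma coind_bond_comp f g h (fg : (f <= g)%O) (gh : (g <= h)%O) (fh : (f <= h)%O) x :
  coind_bond fg (coind_bond gh x) = coind_bond fh x.
Proof.
apply: functional_extensionality_dep => -[e p]; exact: (@coind_irr h x e).
Qed.

Definition coind : invsys T := @InvSys _ _ coind_obj coind_bond coind_bond_id coind_bond_comp.

End Coinduced.

Lemma bond_irr (M : invsys T) f g (p q : (f <= g)%O) x : bond M p x = bond M q x.
Proof. by rewrite (bool_irrelevance p q). Qed.

Section Unit.
Variable M : invsys T.

Definition unit_map f (x : M f) : coind M f := fun z => bond M (valP z) x.

Lemma unit_map_zmod f : zmod_morphism (@unit_map f).
Proof. by move=> x y; apply: functional_extensionality_dep => z; exact: raddfB. Qed.

HB.instance Definition _ f :=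
  GRing.isZmodMorphism.Build (M f) (coind M f) (@unit_map f) (@unit_map_zmod f).

Lemma unit_map_bond f g (fg : (f <= g)%O) x :
  unit_map (bond M fg x) = bond (coind M) fg (unit_map x).
Proof.
apply: functional_extensionality_dep => z; rewrite /unit_map /= /coind_bond.
exact: bond_comp.
Qed.

Definition unit_mor : invmor M (coind M) := @InvMor _ _ M (coind M) unit_map unit_map_bond.

Lemma unit_mono : mono unit_mor.
Proof.
move=> f x y /(congr1 (fun phi : coind M f => phi (exist _ f (lexx f)))) /=.
by rewrite /unit_map /= !bond_id.
Qed.

(* Tuples of cochains take values in the product of all M h; the elements of
   M f are embedded by their restrictions to the h <= f. *)
Definition tot : zmodType := dprod (fun h => M h).

Definition local f (phi : tot) := forall h (hf : (h <= f)%O), phi h = bond M hf (phi f).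

Definition spread f (x : M f) : tot := fun h =>
  match pselect (h <= f)%O with left p => bond M p x | right _ => 0 end.

Lemma spreadE f (x : M f) h (hf : (h <= f)%O) : spread x h = bond M hf x.
Proof. by rewrite /spread; case: pselect => // p; exact: bond_irr. Qed.

Lemma spread_self f (x : M f) : spread x f = x.
Proof. by rewrite (spreadE _ (lexx f)) bond_id. Qed.

Lemma spread_local f (x : M f) : local f (spread x).
Proof. by move=> h hf; rewrite spread_self spreadE. Qed.

Lemma local_subgroup f : subgroup (local f).
Proof.
split=> [|a b la lb] h hf; first by rewrite [RHS]raddf0.
by rewrite !dprodB la lb raddfB.
Qed.

Lemma local_le f g phi : (f <= g)%O -> local g phi -> local f phi.
Proof.
move=> fg lg h hf; rewrite (lg _ fg) (lg _ (le_trans hf fg)).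
by symmetry; exact: bond_comp.
Qed.

Definition leT f g : Prop := (f <= g)%O.

Definition cochain p (x : seq T -> tot) := forall f s,
  Srt leT (f :: s) -> size s = p -> local f (x (f :: s)).

Definition cobd_closed p (x : seq T -> tot) := forall f s,
  Srt leT (f :: s) -> size s = p.+1 -> cobd x (f :: s) f = 0.

Lemma cochainB p x y : cochain p x -> cochain p y -> cochain p (fun s => x s - y s).
Proof. by move=> cx cy f s fs ss; apply: (proj2 (local_subgroup f)); auto. Qed.

Lemma cochain_cobd p x : cochain p x -> cochain p.+1 (cobd x).
Proof.
move=> cx f s fs ss; apply: cobd_ind.
- by case: (local_subgroup f).
- by case: (local_subgroup f).
case=> [/drop1_size/=|b t ft]; first by rewrite ss.
apply: (local_le (drop1_head _ fs ft)); first by move=> ?; exact: lexx.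
apply: cx; first exact: drop1_Srt ft fs.
by have := drop1_size ft; rewrite /= ss => -[].
Qed.

End Unit.

(** An injective system is a retract of the coinduced system it embeds in. There, prepending [h] in
    coordinate [h] is a contracting homotopy, and the retraction [r] carries it over. *)
Lemma injective_acyclic (I : invsys T) p (c : seq T -> tot I) : injective_sys I ->
  cochain p.+1 c -> cobd_closed p.+1 c ->
  exists2 u, cochain p u & forall f s, Srt leT (f :: s) -> size s = p.+1 ->
    c (f :: s) f = cobd u (f :: s) f.
Proof.
move=> inj cc clc.
pose idm : invmor I I := @InvMor _ _ I I (fun f => idfun) (fun f g fg x => erefl).
have [r rP] := inj _ _ (unit_mor I) idm (@unit_mono I).
pose cone (f : T) (t : seq T) : coind I f := fun z => c (val z :: t) (val z).
pose u s : tot I := if s is f :: t then spread (r f (cone f (f :: t))) else 0.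
exists u; first by move=> f s _ _; exact: spread_local.
move=> f s fs ss; rewrite cobd_dprod.
have -> : cobd (fun t => u t f) (f :: s) = cobd (fun t => r f (cone f t)) (f :: s).
  apply: eq_cobd => -[/drop1_size/=|b t ft]; first by rewrite ss.
  have fb : (f <= b)%O by apply: (drop1_head _ fs ft) => ?; exact: lexx.
  rewrite /u (spreadE _ fb) -mor_bond; congr (r f _).
rewrite -(cobd_morph (r f)).
have -> : cobd (cone f) (f :: s) = unit_map (c (f :: s) f).
  apply: functional_extensionality_dep => z; rewrite cobd_dprod /cone /unit_map.
  have lz : Srt leT (val z :: f :: s).
    by apply: Srt_cons (valP z) fs => g f1 f2; exact: le_trans.
  have := clc _ _ lz; rewrite /= ss => /(_ erefl) /eqP.
  rewrite dprodB subr_eq0 => /eqP; rewrite (cc _ _ fs ss _ (valP z)) => ->.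
  by rewrite dprodB cobd_dprod.
by have := rP f (c (f :: s) f).
Qed.

End Systems.

(** * Cohomology of an injective resolution *)

Section Chase.
Context {d : Order.disp_t} {T : porderType d}.
Variables (A : invsys T) (R : inj_resolution A).
Implicit Types (f g h : T) (s t : seq T).
Notation I := (res R).
Notation dd := (res_d R).

Lemma res_dd k f (x : I k f) : dd k.+1 f (dd k f x) = 0.
Proof. by apply/res_exact; exists x. Qed.

Definition tot_d k (phi : tot (I k)) : tot (I k.+1) := fun h => dd k h (phi h).

Lemma tot_d_zmod k : zmod_morphism (@tot_d k).
Proof. by move=> x y; apply: functional_extensionality_dep => h; exact: raddfB. Qed.

HB.instance Definition _ k :=
  GRing.isZmodMorphism.Build (tot (I k)) (tot (I k.+1)) (@tot_d k) (@tot_d_zmod k).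

Lemma tot_d_local k f (phi : tot (I k)) : local f phi -> local f (tot_d phi).
Proof. by move=> lf h hf; rewrite /tot_d (lf _ hf) mor_bond. Qed.

(* Cochains with values in the cycles Z_k = ker (I_k -> I_(k+1)). *)
Definition cycle_cochain k p (x : seq T -> tot (I k)) := cochain p x /\
  forall f s, Srt leT (f :: s) -> size s = p -> dd k f (x (f :: s) f) = 0.

Definition cycle_acyclic k p := forall x : seq T -> tot (I k),
  cycle_cochain p.+1 x -> cobd_closed p.+1 x ->
  exists2 y, cycle_cochain p y & forall f s, Srt leT (f :: s) -> size s = p.+1 ->
    x (f :: s) f = cobd y (f :: s) f.

(** If [x] is the coboundary of [u] in [I k], the differential of [u] is a cocycle of the complex of
    limits. Subtracting from [u] a preimage [y] in the limit leaves a primitive in the cycles. *)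
Lemma cycle_acyclic0 k :
  (forall x, @cocycle _ _ A R k.+1 x -> @coboundary _ _ A R k.+1 x) -> cycle_acyclic k 0.
Proof.
move=> H x [cx zx] clx.
have [u cu xu] := injective_acyclic (@res_inj _ _ _ R k) cx clx.
have s1 f g : (f <= g)%O -> Srt leT [:: f; g] by [].
have du f g : (f <= g)%O -> dd k f (u [:: g] f) = dd k f (u [:: f] f).
  move=> fg; have := zx f [:: g] (s1 f g fg) erefl.
  rewrite (xu f [:: g] (s1 f g fg) erefl) /= subr0 dprodB raddfB => /eqP.
  by rewrite subr_eq0 => /eqP.
have [|y yl yE] := H (fun f => dd k f (u [:: f] f)).
  split=> [f g fg|f]; last exact: res_dd.
  by rewrite -mor_bond -(du f g fg); congr (dd k f _); rewrite -(cu g [::]).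
exists (fun s => u s - (y : tot (I k))).
  split=> [f s fs ss|f s fs /size0nil ->]; last first.
    by rewrite dprodB raddfB -yE subrr.
  apply: (proj2 (local_subgroup (I k) f)); first exact: cu.
  by move=> h hf; rewrite yl.
move=> f s fs ss; rewrite xu// cobd_zmod dprodB [X in _ - X](_ : _ = 0) ?subr0//.
by case: s ss {fs} => // g [|//] _; rewrite /= subr0 subrr.
Qed.

(** Dimension shift along 0 -> Z_k -> I_k -> Z_(k+1) -> 0: the differential of a primitive [u] is a
    cocycle in Z_(k+1); a primitive of it is lifted to [w], and [u - cobd w] has values in Z_k. *)
Lemma cycle_acyclicS k p : cycle_acyclic k.+1 p -> cycle_acyclic k p.+1.
Proof.
move=> H x [cx zx] clx.
have [u cu xu] := injective_acyclic (@res_inj _ _ _ R k) cx clx.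
have [|f s fs ss|v [cv zv] uv] := H (fun s => tot_d (u s)).
- by split=> f s fs ss; [apply: tot_d_local; apply: cu|exact: res_dd].
- rewrite -(cobd_morph (@tot_d k)) -[LHS]/(dd k f (cobd u (f :: s) f)) -xu//.
  exact: zx.
have /choice[w wP] : forall s, exists e : tot (I k), forall f t, s = f :: t -> Srt leT s ->
    size t = p -> local f e /\ dd k f (e f) = v s f.
  move=> [|f t]; first by exists 0.
  have [[fs st]|nf] := pselect (Srt leT (f :: t) /\ size t = p); last first.
    by exists 0 => f' t' [<- <-] fs st; case: nf.
  have /res_exact[e eE] := zv f t fs st.
  by exists (spread e) => _ _ [<- <-] _ _; rewrite spread_self; split=> //; exact: spread_local.
have cw : cochain p w by move=> f t fs st; have [] := wP (f :: t) f t erefl fs st.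
exists (fun s => u s - cobd w s).
  split; first by apply: cochainB cu _; exact: cochain_cobd.
  move=> f s fs ss; rewrite dprodB raddfB.
  rewrite -[dd k f (u _ f)]/(tot_d (u (f :: s)) f) uv//.
  rewrite -[dd k f _]/(tot_d (cobd w (f :: s)) f) (cobd_morph (@tot_d k)) !cobd_dprod -cobd_zmod.
  apply: (@cobd_ind _ _ (fun e => e = 0)) => [//|a b -> ->|]; first by rewrite subrr.
  case=> [/drop1_size/=|b t ft]; first by rewrite ss.
  have fb : (f <= b)%O by apply: (drop1_head _ fs ft) => ?; exact: lexx.
  have st : size t = p by have := drop1_size ft; rewrite /= ss => -[].
  have bt := drop1_Srt ft fs.
  have [wl wE] := wP _ _ _ erefl bt st.
  rewrite /= (cv b t bt st _ fb) -wE /tot_d (wl _ fb) mor_bond subrr //.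
move=> f s fs ss; rewrite xu// cobd_zmod cobdK subr0 //.
Qed.

Lemma augmentation_acyclic n :
  (forall x, @cocycle _ _ A R n.+1 x -> @coboundary _ _ A R n.+1 x) -> cycle_acyclic 0 n.
Proof.
move=> H; suff : forall p k, (k + p = n)%N -> cycle_acyclic k p by apply.
elim=> [|p IH] k kp; first by apply: cycle_acyclic0; rewrite -kp addn0 in H.
by apply: cycle_acyclicS; apply: IH; rewrite addSnnS.
Qed.

End Chase.

(** * Vanishing of the derived limit trivializes cocycles *)

Section DirectSums.
Variable G : zmodType.
Notation EG := (nat * nat -> G).

Lemma leT_fn : @leT _ fn = le_all.
Proof.
apply/funext => f; apply/funext => g; apply/propext; rewrite /leT.
split=> [/lefP fg i|fg]; first by have := fg i; rewrite leEnat.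
by apply/lefP => i; rewrite leEnat; apply: fg.
Qed.

Definition toSum f (e : EG) : dsum G f := insubd (0 : dsum G f) (cutoff f e).

Lemma toSumK f e : Sfin f e -> val (toSum f e) = cutoff f e.
Proof.
move=> fe; rewrite val_insubd ifT//; apply/asboolP.
have /SfinP fin := fe.
apply: (@sub_finite_set _ _ ((val : Idx f -> nat * nat) @^-1` _)); last first.
  by apply: (finite_preimage _ fin) => u v _ _; apply: val_inj.
by move=> u /= /eqP; split=> //; exact: (valP u).
Qed.

Lemma toSum_restr f g e : (f <= g)%O -> Sfin g e -> dsum_restr f g (toSum g e) = toSum f e.
Proof.
move=> fg ge.
have fgs : le_star f g by apply: le_all_star; rewrite -leT_fn.
apply: val_inj; rewrite /= !toSumK//; last exact: Sfin_le ge.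
apply/funext => u; rewrite /restr /cutoff.
have ug : ((val u).2 < g (val u).1)%N.
  apply: leq_trans (valP u) _; have : le_all f g by rewrite -leT_fn.
  exact.
by rewrite insubT.
Qed.

Lemma toSum_surj f (a : dsum G f) : exists2 e, Sfin f e & toSum f e = a.
Proof.
pose e (p : nat * nat) : G := if insub p is Some u then val a u else 0.
have ea : cutoff f e = val a by apply/funext => u; rewrite /cutoff /e valK.
have fe : Sfin f e.
  have /asboolP fin := valP a; apply/SfinP.
  apply: (sub_finite_set _ (finite_image val fin)) => p /= [pf ne].
  exists (exist _ p pf) => //=; apply/eqP; move: ne; rewrite /e.
  by rewrite (insubT (fun p => p.2 < f p.1)%N pf).
by exists e => //; apply: val_inj; rewrite toSumK.
Qed.

Variable R : inj_resolution (sysA G).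
Notation I := (res R).
Notation aug := (res_aug R).

Definition augment (e : EG) : tot (I 0) := fun h => aug h (toSum h e).

Lemma augment_local f e : Sfin f e -> local f (augment e).
Proof.
move=> fe h hf; rewrite /augment -(mor_bond aug hf) /=; congr (aug h _).
by rewrite toSum_restr.
Qed.

Lemma augment_cobd f s (x : seq fn -> EG) : (forall t, drop1 s t -> Sfin f (x t)) ->
  cobd (fun t => augment (x t)) s f = aug f (toSum f (cobd x s)).
Proof.
move=> xf; rewrite cobd_dprod -(cobd_morph (aug f)); congr (aug f _).
apply: val_inj; rewrite (cobd_morph (\val : dsum G f -> Idx f -> G)).
rewrite toSumK; last by apply: cobd_ind => //; case: (Sfin_subgroup G f).
rewrite (cobd_morph (cutoff f)); apply: eq_cobd => t st /=; apply: toSumK; exact: xf.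
Qed.

(** On pointwise increasing tuples [cobd x] has finite support, so it maps to a cocycle in the
    cycles of [I 0]. By exactness a primitive there comes from a finitely supported [a] with the
    same coboundary as [x]. *)
Lemma coherent_trivial n (x : seq fn -> EG) : (0 < n)%N ->
  (forall z, @cocycle _ _ _ R n z -> @coboundary _ _ _ R n z) ->
  cocycle_on (@Sfin G) le_star (fun=> True) n x ->
  exists y, eq_on (@Sfin G) le_star (fun=> True) n x (cobd y).
Proof.
case: n => // n _ H cx.
have xfin f s : Srt leT (f :: s) -> size s = n.+1 -> Sfin f (cobd x (f :: s)).
  rewrite leT_fn => fs ss; apply: cx => //; first exact: All_true.
  exact: Srt_sub le_all_star fs.
have ffin f s t : Srt leT (f :: s) -> size s = n.+2 -> drop1 (f :: s) t -> Sfin f (cobd x t).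
  move=> fs ss; case: t => [/drop1_size/=|b t ft]; first by rewrite ss.
  have fb : leT f b by apply: (drop1_head _ fs ft) => ?; exact: lexx.
  rewrite leT_fn in fb; apply: Sfin_le (le_all_star fb) _; apply: xfin.
    exact: drop1_Srt ft fs.
  by have := drop1_size ft; rewrite /= ss => -[].
have [|f s fs ss|y [cy zy] yE] := augmentation_acyclic H (x := fun s => augment (cobd x s)).
- split=> [f s fs ss|f s fs ss]; first by apply: augment_local; apply: xfin.
  by apply/res_exact0; exists (toSum f (cobd x (f :: s))).
- rewrite augment_cobd => [|t ft]; last exact: ffin ft.
  rewrite cobdK (_ : toSum f 0 = 0) ?raddf0//.
  by apply: val_inj; rewrite toSumK ?raddf0//; case: (Sfin_subgroup G f).
have /choice[a aP] : forall s, exists e, forall f t, s = f :: t -> Srt leT s -> size t = n ->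
    Sfin f e /\ forall h, (h <= f)%O -> y s h = augment e h.
  move=> [|f t]; first by exists 0.
  have [[fs st]|nf] := pselect (Srt leT (f :: t) /\ size t = n); last first.
    by exists 0 => f' t' [<- <-] fs st; case: nf.
  have /res_exact0[b bE] := zy f t fs st.
  have [e fe eb] := toSum_surj b.
  exists e => _ _ [<- _] _ _; split=> // h hf.
  by rewrite (cy f t fs st h hf) (augment_local fe hf) /augment eb bE.
apply: (trivial_of_dsum (a := a)) => // [f s fs [ss]|f s fs ss i j ij].
  by rewrite -leT_fn in fs; have [] := aP (f :: s) f s erefl fs ss.
rewrite -leT_fn in fs.
have := yE f s fs ss; rewrite cobd_dprod.
have afin t : drop1 (f :: s) t -> Sfin f (a t) /\ y t f = augment (a t) f.
  case: t => [/drop1_size/=|b t ft]; first by rewrite ss.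
  have fb : (f <= b)%O by apply: (drop1_head _ fs ft) => ?; exact: lexx.
  have st : size t = n by have := drop1_size ft; rewrite /= ss => -[].
  have [ab yb] := aP _ _ _ erefl (drop1_Srt ft fs) st.
  split; last exact: yb.
  by apply: Sfin_le ab; apply: le_all_star; rewrite -leT_fn.
rewrite (@eq_cobd _ _ _ (fun t => augment (a t) f)); last by move=> t /afin[].
have <- := cobd_dprod (fun t => augment (a t)) (f :: s) f.
rewrite augment_cobd; last by move=> t /afin[].
move=> /res_mono /(congr1 val); rewrite !toSumK; first last.
- exact: xfin.
- by apply: cobd_ind; [case: (Sfin_subgroup G f)|case: (Sfin_subgroup G f)|move=> t /afin[]].
by move=> /(congr1 (fun phi : Idx f -> G => phi (exist _ (i, j) ij))).
Qed.

End DirectSums.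

(** * Injective resolutions *)

Definition QZ_dual (M : zmodType) : Type := {h : M -> QZ | zmod_morphism h}.

(** An injective group, as a product of divisible groups; it contains [M] because homomorphisms to
    Q/Z separate points. *)
Definition QZ_hull (M : zmodType) : zmodType := dprod (fun _ : QZ_dual M => QZ).

Definition QZ_eval (M : zmodType) (x : M) : QZ_hull M := fun h => sval h x.

Lemma QZ_eval_zmod M : zmod_morphism (@QZ_eval M).
Proof. by move=> x y; apply: functional_extensionality_dep => -[h hB]; exact: hB. Qed.

HB.instance Definition _ M :=
  GRing.isZmodMorphism.Build M (QZ_hull M) (@QZ_eval M) (@QZ_eval_zmod M).

Lemma QZ_eval_inj M : injective (@QZ_eval M).
Proof.
move=> x y xy; apply/eqP; rewrite -subr_eq0; apply: contraT => /QZ_separates[h [hB]].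
have := congr1 (fun e : QZ_hull M => e (exist _ h hB)) xy; rewrite /QZ_eval /= => E.
by rewrite hB E subrr eqxx.
Qed.

Lemma QZ_hull_extend M (A B : zmodType) (m : {additive A -> B}) (h : {additive A -> QZ_hull M}) :
  injective m -> exists h' : B -> QZ_hull M, zmod_morphism h' /\ forall a, h' (m a) = h a.
Proof.
move=> minj.
have /choice[e eP] : forall j : QZ_dual M, exists e : B -> QZ, zmod_morphism e /\ forall a, e (m
  a) = h a j.
  move=> j.
  have [|e [eB eE]] := @functional_total B QZ QZ_div [set z | exists a, z = (m a, h a j)].
    split; first split.
    - by exists 0; rewrite !raddf0.
    - by move=> _ _ [a ->] [b ->]; exists (a - b); rewrite !raddfB.
    move=> x [a [E ->]]; rewrite (minj a 0) ?raddf0 // -E.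
  by exists e; split=> // a; apply: eE; exists a.
exists (fun b j => e j b); split.
  by move=> x y; apply: functional_extensionality_dep => j; case: (eP j).
by move=> a; apply: functional_extensionality_dep => j; case: (eP j).
Qed.

Definition img (A B : zmodType) (h : {additive A -> B}) : {pred B} :=
  fun b => `[< exists a, h a = b >].

Lemma img_zmod_closed A B h : zmod_closed (@img A B h).
Proof.
split=> [|x y /asboolP[a <-] /asboolP[b <-]]; apply/asboolP.
  by exists 0; rewrite raddf0.
by exists (a - b); rewrite raddfB.
Qed.

HB.instance Definition _ A B h := GRing.isZmodClosed.Build B (@img A B h) (img_zmod_closed h).

Section Resolution.
Context {d : Order.disp_t} {T : porderType d}.
Implicit Types M A B : invsys T.

Definition inj_hull M : invsys T := coind (fun f => QZ_hull (M f)).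

(** A morphism into a coinduced system is determined by its top coordinates. These are extended for
    each index separately and spread along the bonding maps. *)
Lemma inj_hull_injective M : injective_sys (inj_hull M).
Proof.
move=> A B m h minj.
have ext (f : T) : {e : B f -> QZ_hull (M f) |
    zmod_morphism e /\ forall a, e (m f a) = h f a (exist _ f (lexx f))}.
  apply: cid.
  pose hf (a : A f) : QZ_hull (M f) := h f a (exist _ f (lexx f)).
  have hfB : zmod_morphism hf by move=> x y; rewrite /hf raddfB.
  pose hfA : {additive A f -> QZ_hull (M f)} :=
    HB.pack hf (GRing.isZmodMorphism.Build _ _ hf hfB).
  exact: (QZ_hull_extend hfA (minj f)).
pose e f := projT1 (ext f); have eP f := projT2 (ext f).
pose h' f (b : B f) : inj_hull M f := fun z => e (val z) (bond B (valP z) b).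
have h'B f : zmod_morphism (h' f).
  move=> x y; apply: functional_extensionality_dep => z.
  by rewrite /h' raddfB; exact: (proj1 (eP (val z))).
pose h'A f : {additive B f -> inj_hull M f} :=
  HB.pack (h' f) (GRing.isZmodMorphism.Build _ _ (h' f) (h'B f)).
have h'bond f g (fg : (f <= g)%O) x : h'A f (bond B fg x) = bond (inj_hull M) fg (h'A g x).
  apply: functional_extensionality_dep => z.
  by rewrite /= /coind_bond /h' /=; congr (e _ _); exact: bond_comp.
exists (InvMor h'bond) => f a; apply: functional_extensionality_dep => -[g gf].
apply: (@etrans _ _ (e g (m g (bond A gf a)))).
  by rewrite mor_bond; congr (e g _); exact: bond_irr.
apply: etrans (proj2 (eP g) _) _; rewrite (mor_bond h gf).
exact: (@coind_irr _ _ (fun f => QZ_hull (M f)) f (h f a) g).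
Qed.

Definition hull_map M f (x : M f) : inj_hull M f := fun z => QZ_eval (bond M (valP z) x).

Lemma hull_map_zmod M f : zmod_morphism (@hull_map M f).
Proof. by move=> x y; apply: functional_extensionality_dep => z; rewrite /hull_map !raddfB. Qed.

HB.instance Definition _ M f :=
  GRing.isZmodMorphism.Build (M f) (inj_hull M f) (@hull_map M f) (@hull_map_zmod M f).

Lemma hull_map_bond M f g (fg : (f <= g)%O) x :
  hull_map (bond M fg x) = bond (inj_hull M) fg (hull_map x).
Proof.
apply: functional_extensionality_dep => z; rewrite /hull_map /= /coind_bond.
by congr (QZ_eval _); exact: bond_comp.
Qed.

Definition hull_mor M : invmor M (inj_hull M) :=
  @InvMor _ _ M (inj_hull M) (fun f => @hull_map M f) (@hull_map_bond M).

Lemma hull_mono M : mono (hull_mor M).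
Proof.
move=> f x y /(congr1 (fun phi : inj_hull M f => phi (exist _ f (lexx f)))) /=.
by rewrite /hull_map /= => /QZ_eval_inj; rewrite !bond_id.
Qed.

Section Cokernel.
Variables (A B : invsys T) (m : invmor A B).

Definition coker_obj f : zmodType := Quotient.quot (img (m f)).

Definition coker_pi f (b : B f) : coker_obj f := \pi_(coker_obj f)%qT b.

Lemma coker_pi_zmod f : zmod_morphism (@coker_pi f).
Proof. by move=> x y; rewrite /coker_pi raddfB. Qed.

HB.instance Definition _ f :=
  GRing.isZmodMorphism.Build (B f) (coker_obj f) (@coker_pi f) (@coker_pi_zmod f).

Lemma coker_pi_eq0 f b : coker_pi b = 0 <-> exists a, m f a = b.
Proof.
rewrite -(raddf0 (@coker_pi f)); split=> [/eqP|ab].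
  by rewrite -Quotient.idealrBE subr0 => /asboolP.
by apply/eqP; rewrite -Quotient.idealrBE subr0; apply/asboolP.
Qed.

Lemma coker_pi_repr f (x : coker_obj f) : coker_pi (repr x) = x.
Proof. exact: reprK. Qed.

Definition coker_bond f g (fg : (f <= g)%O) (x : coker_obj g) : coker_obj f :=
  coker_pi (bond B fg (repr x)).

Lemma coker_bond_pi f g (fg : (f <= g)%O) b : coker_bond fg (coker_pi b) = coker_pi (bond B fg b).
Proof.
apply/eqP; rewrite -subr_eq0 -raddfB /= -raddfB; apply/eqP/coker_pi_eq0.
have /coker_pi_eq0[a aE] : coker_pi (repr (coker_pi b) - b) = 0.
  by rewrite raddfB /= coker_pi_repr subrr.
by exists (bond A fg a); rewrite mor_bond aE.
Qed.

Lemma coker_bond_zmod f g fg : zmod_morphism (@coker_bond f g fg).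
Proof.
move=> x y; rewrite -(coker_pi_repr x) -(coker_pi_repr y) -raddfB /= !coker_bond_pi.
by rewrite -raddfB /= -raddfB.
Qed.

HB.instance Definition _ f g fg := GRing.isZmodMorphism.Build (coker_obj g) (coker_obj f)
  (@coker_bond f g fg) (@coker_bond_zmod f g fg).

Lemma coker_bond_id f (ff : (f <= f)%O) x : coker_bond ff x = x.
Proof. by rewrite -(coker_pi_repr x) coker_bond_pi bond_id. Qed.

Lemma coker_bond_comp f g h (fg : (f <= g)%O) (gh : (g <= h)%O) (fh : (f <= h)%O) x :
  coker_bond fg (coker_bond gh x) = coker_bond fh x.
Proof. by rewrite -(coker_pi_repr x) !coker_bond_pi (bond_comp fg gh fh). Qed.

Definition coker : invsys T :=
  @InvSys _ _ coker_obj coker_bond coker_bond_id coker_bond_comp.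

End Cokernel.

(** The systems [inj_hull] of these iterated cokernels form the resolution; a differential projects
    to the next cokernel and embeds it in its own [inj_hull]. *)
Fixpoint cosyzygy M k : invsys T := if k is k'.+1 then coker (hull_mor (cosyzygy M k')) else M.

Definition res_map M k f (x : inj_hull (cosyzygy M k) f) : inj_hull (cosyzygy M k.+1) f :=
  hull_mor (cosyzygy M k.+1) f (coker_pi (hull_mor (cosyzygy M k)) x).

Lemma res_map_zmod M k f : zmod_morphism (@res_map M k f).
Proof. by move=> x y; rewrite /res_map !raddfB. Qed.

HB.instance Definition _ M k f := GRing.isZmodMorphism.Build
  (inj_hull (cosyzygy M k) f) (inj_hull (cosyzygy M k.+1) f) (@res_map M k f) (@res_map_zmod M k f).

Lemma res_map_bond M k f g (fg : (f <= g)%O) x :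
  @res_map M k f (bond _ fg x) = bond _ fg (res_map x).
Proof.
rewrite /res_map -mor_bond; congr (hull_mor _ _ _); symmetry.
exact: (coker_bond_pi (hull_mor (cosyzygy M k)) fg x).
Qed.

Lemma res_map_eq0 M k f (x : inj_hull (cosyzygy M k) f) :
  res_map x = 0 <-> exists a, hull_mor (cosyzygy M k) f a = x.
Proof.
rewrite -coker_pi_eq0; split=> [|E]; last by rewrite /res_map E raddf0.
by rewrite -(raddf0 (hull_mor (cosyzygy M k.+1) f)) => /hull_mono.
Qed.

Lemma inj_resolution_ex M : inhabited (inj_resolution M).
Proof.
split; apply: (@InjResolution _ _ M (fun k => inj_hull (cosyzygy M k))
  (fun k => @inj_hull_injective _) (hull_mor M)
  (fun k => @InvMor _ _ _ _ (fun f => @res_map M k f) (@res_map_bond M k))).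
- exact: hull_mono.
- by move=> f x; exact: (@res_map_eq0 M 0 f x).
move=> k f x; apply: (iff_trans (@res_map_eq0 M k.+1 f x)); split=> [[a <-]|[y <-]].
  exists (repr (a : coker_obj (hull_mor (cosyzygy M k)) f)).
  exact: (congr1 (hull_mor (cosyzygy M k.+1) f) (coker_pi_repr _)).
by exists (coker_pi (hull_mor (cosyzygy M k)) y).
Qed.

End Resolution.

Theorem theorem4p11 (n : nat) (C : set (nat -> nat)) :
  (1 <= n)%N ->
  cofinality_is le_star [set: nat -> nat] (aleph n) ->
  wchain (omega n) le_star C ->
  unbounded le_star C ->
  (forall k : nat, (k < n)%N -> weak_diamond (Scof k)) ->
  card_lt [set: omega 0 -> bool] [set: omega 1 -> bool] ->
  forall G : zmodType, (exists g : G, g != 0) ->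
    (exists x : cfamily G n [set: nat -> nat],
       coherent x /\ nontrivial_on (@subsetT _ C) x) /\
    lim_derived_neq0 n (sysA G).
Proof.
case: n => // k _ [[A [_ Acof] /card_eqPle[Ale _]] _] [c [cC _ csurj] cmono] Cunb WD _ G [g0
  g0_neq0].
(* A dominating family of the given size serves as the set of generators. *)
have idealT : ideal A = fun=> True.
  apply/funext => f; apply/propext; split=> // _.
  by have [a Aa fa] := Acof f I; apply: ideal_down fa (ideal_gen Aa).
have [h [hB hg0]] := QZ_separates g0_neq0.
pose pi : {additive G -> QZ} := HB.pack h (GRing.isZmodMorphism.Build _ _ h hB).
(* Q/Z is countable: its elements are coded through rational representatives. *)
have cinj : injective (fun q : QZ => pickle (repr q)).
  by move=> p q /(pcan_inj pickleK) E; rewrite -[p]toQZ_surj E toQZ_surj.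
have [|||x [xc xnt]] := @chain_nontrivial G QZ pi g0 hg0 _ cinj k WD A c _ cmono.
- exact: card_into (omega_inh _) Ale.
- by move=> i; rewrite idealT.
- move=> p _; apply: contrapT => /forallNP H; apply: Cunb; exists p => _ /csurj[i _ <-].
  exact: contrapT (H i).
rewrite idealT in xc.
(* A trivialization over G, composed with [pi], would be one over Q/Z. *)
have nw : ~ exists w, forall i s, Srt (fun i j : omega k.+1 => wle i j) (i :: s) ->
    size s = k -> Sfin (c i) (x (map c (i :: s)) - cobd w (i :: s)).
  move=> [w wP]; apply: xnt; exists (fun s => push pi (w s)) => i s ss sk.
  by have := push_Sfin pi (wP i s ss sk); rewrite (raddfB (push pi)) (cobd_morph (push pi)).
split.
  exists (cfamily_of k.+1 x); split; first exact: cfamily_of_coherent.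
  by apply: cfamily_of_nontrivial cmono _ nw => i; apply: cC.
split=> [|R]; first exact: inj_resolution_ex.
apply: contrapT => /forallNP H; apply: nw.
(* A primitive of [x] on all increasing tuples, composed with [c], would trivialize [x] on the
   chain. *)
have [//||y yP] := @coherent_trivial G R k.+1 x _ _ xc.
  by move=> z zc; apply: contrapT => nz; apply: (H z).
exists (fun s => y (map c s)) => i s ss sk.
rewrite -(cobd_map c y (i :: s)); apply: yP => /=.
- by split=> //; apply: All_true.
- by apply/(Srt_map c le_star (i :: s)); apply: Srt_sub ss => a b; apply: cmono.
- by rewrite size_map sk.
Qed.
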